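(* Let $\mathcal{B}^\pm_\infty=((X^\pm_i)_{i\in\mathbb{Z}};T^\pm)$ be the random infinite treed bridge such that $(X^\pm_i)_{i\ge0}$ and $(X^\pm_{-i})_{i\ge0}$ are two independent simple symmetric random walks on $\mathbb{Z}$ started from $X_0^\pm=0$ and, conditionally on $X^\pm$, the trees $T^\pm(i)$, $i\in\mathsf{DS}(X^\pm)$, are independent, $T^\pm(i)$ having law $\rho_{X^\pm_i}$. Consider the Uniform Infinite Half-Planar Quadrangulation constructed as $\mathcal{H}_\infty=\Phi(\mathcal{B}^\pm_\infty)$, and for a vertex $x$ of $\mathcal{H}_\infty$ let $l(x)$ be the label of $x$ in $\mathcal{B}^\pm_\infty$. Then almost surely, for each pair of vertices $x,y$ of $\mathcal{H}_\infty$, $$l(x)-l(y)=\lim_{z\to\infty}\big(\mathrm{d_{gr}}(x,z)-\mathrm{d_{gr}}(y,z)\big),$$ where $\mathrm{d_{gr}}$ is the graph distance in $\mathcal{H}_\infty$ and $z\to\infty$ means that the vertex $z$ leaves any finite region of $\mathcal{H}_\infty$.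
   Context: **Trees.** A labelled plane tree is a finite rooted plane tree $\tau$ with integer labels on its vertices, labels of neighbours differing by at most $1$ in absolute value; $|\tau|$ is its number of edges. $\mathsf{LT}_k$ is the set of those with root label $k\in\mathbb{Z}$, and $\mathsf{LT}=\bigcup_k\mathsf{LT}_k$. One has $\sum_{\tau\in\mathsf{LT}_k}12^{-|\tau|}=2$, and $\rho_k$ is the probability measure on $\mathsf{LT}_k$ with $\rho_k(\{\tau\})=12^{-|\tau|}/2$. **Infinite treed bridges.** An infinite bridge is a sequence $b=(x_i)_{i\in\mathbb{Z}}$ of integers with $x_0=0$ and $|x_{i+1}-x_i|=1$; its set of down-steps is $\mathsf{DS}(b)=\{i:x_{i+1}=x_i-1\}$. An infinite treed bridge is a pair $(b;T)$ with $T:\mathsf{DS}(b)\to\mathsf{LT}$ and $T(i)\in\mathsf{LT}_{x_i}$. It is drawn as the horizontal line with vertices $i\in\mathbb{Z}$ (ordered left to right, labelled $x_i$), with $T(i)$ grafted at vertex $i$ in the upper half-plane. Vertices of the trees $T(i)$ (roots included) are real; vertices $i\notin\mathsf{DS}(b)$ of the line are phantom. $\mathsf{TB}^{-\infty}$ is the set of infinite treed bridges with $\liminf_{i\to+\infty}x_i=\liminf_{i\to-\infty}x_i=-\infty$; $\mathcal{B}^\pm_\infty\in\mathsf{TB}^{-\infty}$ almost surely. **The map $\Phi$ on $\mathsf{TB}^{-\infty}$.** List the real corners (corners at real vertices in the upper face) in the order of the left-to-right contour of the upper face as $(c_k)_{k\in I}$; $l(c)$ is the label of the vertex $v(c)$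 of $c$. The successor of $c_i$ is $s(c_i)=c_j$ with $j=\min\{h>i:l(c_h)=l(c_i)-1\}$. Draw an edge from each real corner to its successor, without crossings, and erase phantom vertices, labels and all original edges. The result is a locally finite quadrangulation with an infinite (general) boundary whose vertices are exactly the real vertices of $(b;T)$ and whose boundary edges correspond to the edges of the line. It is rooted at the boundary edge corresponding to the edge $(0,1)$ of the line: if $x_1=-1$ this is the edge from the rightmost corner of vertex $0$ to its successor, oriented away from vertex $0$; if $x_1=1$ it is the edge between $c'$ and $s(c')$ oriented from $v(s(c'))$ to $v(c')$, where $c'$ is the first real corner labelled $1$ at or after vertex $1$ in the contour. (A quadrangulation with a boundary is a planar map all of whose faces are quadrangles except for one, the outerface, lying on the right of the root edge.) **UIHPQ.** It is known that $\Phi(\mathcal{B}^\pm_\infty)$ has the law of the UIHPQ, i.e. of the local limit in distribution, as first $n\to\infty$ and then $p\to\infty$, of uniform rooted quadrangulations with $n$ inner faces and a general boundary of length $2p$. *)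

(* Defs.v *)
From HB Require Import structures.
From mathcomp Require Import all_boot all_order all_algebra.
From mathcomp Require Import all_classical all_reals all_analysis.

Set Implicit Arguments.
Unset Strict Implicit.
Unset Printing Implicit Defensive.

Import Order.TTheory GRing.Theory Num.Theory.
Import numFieldNormedType.Exports.

Local Open Scope classical_set_scope.
Local Open Scope ring_scope.

Inductive ltree : Type := LNode of int & seq ltree.

Definition root_label (t : ltree) : int := let: LNode k _ := t in k.

Definition children (t : ltree) : seq ltree := let: LNode _ ts := t in ts.

Fixpoint nb_edges (t : ltree) : nat :=
  let: LNode _ ts := t in sumn (map (fun c => (nb_edges c).+1) ts).

Fixpoint well_labelled (t : ltree) : bool :=
  let: LNode k ts := t in
  all (fun c => (`|root_label c - k| <= 1) && well_labelled c) ts.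

Definition LT (k : int) (t : ltree) : bool :=
  well_labelled t && (root_label t == k).

Definition rho (R : realType) (k : int) (t : ltree) : R :=
  if LT k t then 12%:R ^- nb_edges t / 2%:R else 0.

(* Vertices of a plane tree are addressed by the list of child indices read
   from the root (Ulam-Harris encoding). *)
Definition child (t : ltree) (j : nat) : ltree := nth (LNode 0 [::]) (children t) j.

Fixpoint tree_vertex (t : ltree) (u : seq nat) : bool :=
  if u is j :: u' then (j < size (children t))%N && tree_vertex (child t j) u'
  else true.

Fixpoint subtree (t : ltree) (u : seq nat) : ltree :=
  if u is j :: u' then subtree (child t j) u' else t.

(* The vertices met by the left-to-right contour of the tree, with repetition:
   a vertex with m children is listed m + 1 times.  For a tree grafted in the
   upper half-plane on a horizontal line, the entries are exactly the corners
   in the upper face (also at the root, which is flanked by the line). *)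
Fixpoint contour (t : ltree) : seq (seq nat) :=
  let: LNode _ ts := t in
  let cs := map contour ts in
  [::] :: flatten [seq rcons (map (cons p.1) p.2) [::]
                  | p <- zip (iota 0 (size cs)) cs].

Definition down_steps (x : int -> int) : pred int :=
  fun i => x (i + 1) == x i - 1.

(* [tb_tree i] is meaningful only when [i] is a down-step of the bridge. *)
Record treed_bridge := TreedBridge {
  tb_walk : int -> int;
  tb_tree : int -> ltree;
  tb_walk0 : tb_walk 0 = 0;
  tb_step : forall i, `|tb_walk (i + 1) - tb_walk i| = 1;
  tb_treeP : forall i, down_steps tb_walk i -> LT (tb_walk i) (tb_tree i) }.

Definition DS (b : treed_bridge) : pred int := down_steps (tb_walk b).

Definition real_vertex (b : treed_bridge) : Type :=
  {v : int * seq nat | DS b v.1 && tree_vertex (tb_tree b v.1) v.2}.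

Definition vlabel (b : treed_bridge) (v : real_vertex b) : int :=
  root_label (subtree (tb_tree b (val v).1) (val v).2).

(* The corner [(i, k)] is the [k]-th one in the contour of the tree grafted at
   [i]; the contour of the upper face is the lexicographic order [int *l nat]. *)
Definition real_corner (b : treed_bridge) : Type :=
  {c : int *l nat | DS b c.1 && (c.2 < size (contour (tb_tree b c.1)))%N}.

Definition corner_lt (b : treed_bridge) (c c' : real_corner b) : bool :=
  (val c < val c')%O.

Lemma tree_vertex_contour (t : ltree) (k : nat) :
  (k < size (contour t))%N -> tree_vertex t (nth [::] (contour t) k).
Proof.
move=> kt; have {kt} := mem_nth [::] kt; move: (nth _ _ _) => u {k}.
elim: u t => [//|j u IH] [k ts] /=; rewrite in_cons /= => /flattenP[s].
set cs := map contour ts; set z := zip _ _.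
have sz : size z = size ts by rewrite size_zip size_iota minnn size_map.
move=> /(nthP [::])[n]; rewrite size_map sz => nlt <-.
rewrite (nth_map (0%N, [::])) ?sz// nth_zip ?size_iota//.
rewrite mem_rcons in_cons /= => /mapP[v].
rewrite nth_iota ?size_map// (nth_map (LNode 0 [::]))// => vc [-> uv].
by rewrite add0n /child /= nlt; apply: IH; rewrite uv.
Qed.

Lemma corner_vertex_subproof (b : treed_bridge) (c : real_corner b) :
  let v := ((val c).1, nth [::] (contour (tb_tree b (val c).1)) (val c).2) in
  DS b v.1 && tree_vertex (tb_tree b v.1) v.2.
Proof.
by case: c => -[i k] /= /andP[-> /tree_vertex_contour].
Qed.

Definition corner_vertex (b : treed_bridge) (c : real_corner b) : real_vertex b :=
  exist _ ((val c).1, nth [::] (contour (tb_tree b (val c).1)) (val c).2)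
    (corner_vertex_subproof c).

Definition clabel (b : treed_bridge) (c : real_corner b) : int :=
  vlabel (corner_vertex c).

Definition successor (b : treed_bridge) (c c' : real_corner b) : Prop :=
  [/\ corner_lt c c', clabel c' = clabel c - 1 &
      forall c'', corner_lt c c'' -> clabel c'' = clabel c - 1 ->
        ~~ corner_lt c'' c'].

Record multigraph := Multigraph {
  mvertex : Type;
  medge : Type;
  mtail : medge -> mvertex;
  mhead : medge -> mvertex }.

(* The graph underlying the map [Phi b]: one edge from each real corner to its
   successor.  The planar embedding and the root edge are not recorded, since
   graph distances do not depend on them.  Every corner has a successor as soon
   as the bridge has liminf -oo at +oo. *)
Definition Phi (b : treed_bridge) : multigraph :=
  @Multigraph (real_vertex b)
    {e : real_corner b * real_corner b | successor e.1 e.2}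
    (fun e => corner_vertex (sval e).1) (fun e => corner_vertex (sval e).2).

Definition madj (G : multigraph) (x y : mvertex G) : Prop :=
  exists e : medge G,
    (mtail e = x /\ mhead e = y) \/ (mtail e = y /\ mhead e = x).

Fixpoint mwalk (G : multigraph) (n : nat) (x y : mvertex G) : Prop :=
  if n is m.+1 then exists2 z, madj x z & mwalk m z y else x = y.

(* Equal to +oo when [x] and [y] are not connected. *)
Definition dgr (R : realType) (G : multigraph) (x y : mvertex G) : \bar R :=
  ereal_inf [set (n%:R)%:E | n in [set n : nat | mwalk n x y]].

Definition vinfty (G : multigraph) : set_system (mvertex G) :=
  [set A | cofinite_set A].
Arguments vinfty G : clear implicits.

Section Processes.
Context {d : measure_display} {Omega : measurableType d} {R : realType}.
Variable P : probability Omega R.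

Definition discrete_rv (E : Type) (Y : Omega -> E) : Prop :=
  forall A : set E, measurable (Y @^-1` A).

Definition mutually_independent (I : eqType) (E : Type)
    (Y : I -> Omega -> E) : Prop :=
  forall (J : seq I) (A : I -> set E), uniq J ->
    P [set w | forall i, i \in J -> A i (Y i w)] =
    (\prod_(i <- J) P (Y i @^-1` A i))%E.

Definition sigma_of (I E : Type) (Y : I -> Omega -> E) : set_system Omega :=
  <<s [set B | exists i (A : set E), B = Y i @^-1` A] >>.

Definition independent_processes (I I' E E' : Type)
    (Y : I -> Omega -> E) (Z : I' -> Omega -> E') : Prop :=
  forall A B, sigma_of Y A -> sigma_of Z B -> P (A `&` B) = (P A * P B)%E.

Definition simple_random_walk (S : nat -> Omega -> int) : Prop :=
  let step n w := S n.+1 w - S n w in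
  [/\ forall n, discrete_rv (S n),
      forall w, S 0%N w = 0,
      forall n, P [set w | step n w = 1] = (2^-1)%:E /\
                P [set w | step n w = - 1] = (2^-1)%:E &
      mutually_independent step].

(* Conditionally on the walk [X], the trees grafted at the down-steps are
   independent with laws [rho (X i)]: the conditional probability given
   sigma(X) that the trees at the positions in [J] exist and are equal to [t]
   is the corresponding product. *)
Definition conditionally_independent_trees (X : int -> Omega -> int)
    (T : int -> Omega -> ltree) : Prop :=
  let ds i w := down_steps (X^~ w) i in
  (forall i (A : set ltree), measurable [set w | ds i w /\ A (T i w)]) /\
  forall (A : set Omega) (J : seq int) (t : int -> ltree),
    sigma_of X A -> uniq J ->
    P (A `&` [set w | forall i, i \in J -> ds i w /\ T i w = t i]) =
    (\int[P]_(w in A)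
       (\prod_(i <- J) (if ds i w then rho R (X i w) (t i) else 0))%:E)%E.

Definition is_Binfty (B : Omega -> treed_bridge) : Prop :=
  let X i w := tb_walk (B w) i in
  let T i w := tb_tree (B w) i in
  [/\ simple_random_walk (fun n => X n%:Z),
      simple_random_walk (fun n => X (- n%:Z)),
      independent_processes (fun n : nat => X n%:Z) (fun n : nat => X (- n%:Z)) &
      conditionally_independent_trees X T].

End Processes.

(* Main.v *)
Require Import Defs.
From HB Require Import structures.
From mathcomp Require Import all_boot all_order all_algebra.
From mathcomp Require Import zify lra ring.
From mathcomp Require Import all_classical all_reals all_analysis.

Set Implicit Arguments.
Unset Strict Implicit.
Unset Printing Implicit Defensive.

Import Order.TTheory GRing.Theory Num.Theory.
Import numFieldNormedType.Exports.

Local Open Scope classical_set_scope.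
Local Open Scope ring_scope.

(** If a position [g] of the line is such that every label between [g] and the
    positions of [u] and [v] exceeds [x g], then an edge [c -> s(c)] jumping over
    [g] ends at a vertex visited by the successor chains of all corners of [u] and
    [v]. A walk from [u] or [v] to a vertex [z] on the other side of [g] uses such
    an edge, and a successor chain is a geodesic along which labels decrease by one,
    so [d(u,z) - d(v,z) = l(u) - l(v)]. It remains to find such cuts arbitrarily far
    on both sides.

    Reading the bridge away from [0], the pairs (step, tree shifted to root label
    [0]) are i.i.d., and the levels [- k] reached before any tree label at or below
    [- k] form a renewal set. The probability that a tree has all its labels above
    [- h] is at least [h (h + 3) / ((h + 1) (h + 2))], by comparison with the
    equation obtained by cutting off the first child. With this weight on the
    tree-carrying steps, the probability that [k] belongs to the renewal set is
    bounded below by the harmonic function [1 / (k + 1)] on the right and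
    [3 / (k + 3)] on the left. The sum over [k] diverges, hence the renewal set is
    almost surely infinite. *)

(** * Labelled trees *)

(** Children are nested in a list, so the inner [fix] collects the induction hypotheses of all of
    them. *)
Definition ltree_rect_all (Pr : ltree -> Prop)
    (H : forall k ts, foldr (fun c => and (Pr c)) True ts -> Pr (LNode k ts)) :
    forall t, Pr t :=
  fix F t := let: LNode k ts := t in
    H k ts ((fix G s := match s return foldr (fun c => and (Pr c)) True s with
             | [::] => I | c :: s' => conj (F c) (G s') end) ts).

(** This encoding makes trees countable, so that their laws are determined by atoms. *)
Fixpoint ltree_code (t : ltree) : GenTree.tree nat :=
  let: LNode k ts := t in GenTree.Node (pickle k) (map ltree_code ts).

Fixpoint ltree_decode (g : GenTree.tree nat) : option ltree :=
  if g is GenTree.Node n gs then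
    if unpickle n is Some k then Some (LNode k (pmap ltree_decode gs)) else None
  else None.

Lemma ltree_codeK : pcancel ltree_code ltree_decode.
Proof.
elim/ltree_rect_all => k ts IH /=; rewrite pickleK; congr (Some (LNode _ _)).
by elim: ts IH => //= c ts IHts [-> /IHts /= ->].
Qed.

HB.instance Definition _ := Countable.copy ltree (pcan_type ltree_codeK).

Lemma ltree_ind_in (Pr : ltree -> Prop) :
  (forall k ts, {in ts, forall c, Pr c} -> Pr (LNode k ts)) -> forall t, Pr t.
Proof.
move=> H; elim/ltree_rect_all => k ts IH; apply: H => c.
elim: ts IH => //= c' ts IHts [Pc' /IHts Pts].
by rewrite in_cons => /predU1P[->|/Pts].
Qed.

Fixpoint tshift (a : int) (t : ltree) : ltree :=
  let: LNode k ts := t in LNode (k + a) (map (tshift a) ts).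

Fixpoint above (m : int) (t : ltree) : bool :=
  let: LNode k ts := t in (m < k) && all (above m) ts.

Lemma root_tshift a t : root_label (tshift a t) = root_label t + a.
Proof. by case: t. Qed.

Lemma tshiftD a b t : tshift b (tshift a t) = tshift (a + b) t.
Proof.
elim/ltree_ind_in: t => k ts IH /=; rewrite addrA -map_comp; congr LNode.
by apply/eq_in_map => c /IH.
Qed.

Lemma tshift0 t : tshift 0 t = t.
Proof.
elim/ltree_ind_in: t => k ts IH /=; rewrite addr0; congr LNode.
by rewrite -[RHS]map_id; apply/eq_in_map => c /IH.
Qed.

Lemma tshiftK a : cancel (tshift a) (tshift (- a)).
Proof. by move=> t; rewrite tshiftD subrr tshift0. Qed.

Lemma tshiftNK a : cancel (tshift (- a)) (tshift a).
Proof. by move=> t; rewrite tshiftD addNr tshift0. Qed.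

Lemma nb_edges_tshift a t : nb_edges (tshift a t) = nb_edges t.
Proof.
elim/ltree_ind_in: t => k ts IH /=; rewrite -map_comp; congr sumn.
by apply/eq_in_map => c /IH /= ->.
Qed.

Lemma well_labelled_tshift a t : well_labelled (tshift a t) = well_labelled t.
Proof.
elim/ltree_ind_in: t => k ts IH /=; rewrite all_map; apply: eq_in_all => c cts /=.
by rewrite IH// root_tshift opprD addrACA subrr addr0.
Qed.

Lemma LT_tshift a k t : LT (k + a) (tshift a t) = LT k t.
Proof.
by rewrite /LT well_labelled_tshift root_tshift (inj_eq (addIr a)).
Qed.

Lemma above_tshift a m t : above (m + a) (tshift a t) = above m t.
Proof.
elim/ltree_ind_in: t => k ts IH /=; rewrite ltrD2r all_map; congr (_ && _).
by apply: eq_in_all => c /IH.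
Qed.

Lemma above_subtree m t u :
  above m t -> tree_vertex t u -> m < root_label (subtree t u).
Proof.
elim: u t => [|j u IH] [k ts] /= /andP[mk ab]//.
by move=> /andP[jts]; apply: IH; move/all_nthP: ab => /(_ (LNode 0 [::]) _ jts).
Qed.

Definition contour_labels (t : ltree) : seq int :=
  [seq root_label (subtree t u) | u <- contour t].

Lemma contour_labelsE k ts : contour_labels (LNode k ts) =
  k :: flatten [seq rcons (contour_labels c) k | c <- ts].
Proof.
rewrite /contour_labels /=; congr cons.
rewrite map_flatten; congr flatten; rewrite -map_comp.
set z := zip _ _; have sz : size z = size ts.
  by rewrite size_zip size_iota minnn size_map.
apply: (@eq_from_nth _ [::]); first by rewrite !size_map sz.
move=> i; rewrite size_map sz => its.
rewrite (nth_map (0%N, [::])) ?sz// nth_zip ?size_iota//=.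
rewrite nth_iota ?size_map// !(nth_map (LNode 0 [::]))// map_rcons -map_comp.
congr rcons; apply: eq_map => u /=; by rewrite add0n.
Qed.

(** With [k] as the label of a parent at both ends the induction passes: the contour of a child is
    entered from the parent and left towards it. *)
Lemma contour_labels_path k t : well_labelled t -> `|root_label t - k| <= 1 ->
  path (fun a b : int => `|b - a| <= 1) k (rcons (contour_labels t) k).
Proof.
elim/ltree_ind_in: t k => j ts IH k wts jk; rewrite /= in wts jk.
rewrite contour_labelsE rcons_cons /= jk/=.
have : path (fun a b : int => `|b - a| <= 1) j
    (flatten [seq rcons (contour_labels c) j | c <- ts]) /\
    last j (flatten [seq rcons (contour_labels c) j | c <- ts]) = j.
  elim: ts IH wts => //= c ts IHts IH /andP[/andP[cj wc] /IHts{}IHts].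
  have [|p l] := IHts; first by move=> d dts; apply: IH; rewrite in_cons dts orbT.
  rewrite cat_path last_cat last_rcons p l; split=> //.
  by rewrite IH ?mem_head.
move=> [p l]; rewrite rcons_path p l/=; lia.
Qed.

Lemma contour_labels_step t n : well_labelled t ->
  (n.+1 < size (contour t))%N ->
  `|nth 0 (contour_labels t) n.+1 - nth 0 (contour_labels t) n| <= 1.
Proof.
move=> wt nt.
have := @contour_labels_path (root_label t) t wt.
rewrite subrr normr0 => /(_ isT) /(pathP 0) /(_ n.+1).
rewrite size_rcons size_map => /(_ (leqW nt))/=.
by rewrite !nth_rcons size_map nt (ltnW nt).
Qed.

Lemma contour_labels_last t : last 0 (contour_labels t) = root_label t.
Proof.
case: t => k ts; rewrite contour_labelsE /=.
by elim/last_ind: ts => //= ts c _; rewrite map_rcons flatten_rcons last_cat last_rcons.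
Qed.

Lemma mem_contour t u : tree_vertex t u -> u \in contour t.
Proof.
elim: u t => [|j u IH] [k ts] /=; first by rewrite in_cons.
move=> /andP[jts uj]; rewrite in_cons /=; apply/flattenP.
set cs := map contour ts; set z := zip _ _.
have sz : size z = size ts by rewrite size_zip size_iota minnn size_map.
exists (rcons (map (cons j) (contour (child (LNode k ts) j))) [::]); last first.
  by rewrite mem_rcons in_cons/= map_f// IH.
apply/(nthP [::]); exists j; first by rewrite size_map sz.
rewrite (nth_map (0%N, [::])) ?sz// nth_zip ?size_iota//=.
by rewrite nth_iota ?size_map// !(nth_map (LNode 0 [::])).
Qed.

Lemma contour_gt0 t : (0 < size (contour t))%N.
Proof. by case: t. Qed.

(** * Corners, successors and cuts *)

Section Corners.
Variable b : treed_bridge.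
Implicit Types (c d e : real_corner b) (i j g : int).

Notation x := (tb_walk b).

Definition cpos c : int := (val c).1.
Definition cidx c : nat := (val c).2.

Lemma cposP c : DS b (cpos c).
Proof. by case: c => s p; case/andP: (p). Qed.

Lemma cidxP c : (cidx c < size (contour (tb_tree b (cpos c))))%N.
Proof. by case: c => s p; case/andP: (p). Qed.

Lemma clabelE c :
  clabel c = nth 0 (contour_labels (tb_tree b (cpos c))) (cidx c).
Proof. by rewrite /contour_labels (nth_map [::]) ?cidxP. Qed.

Lemma corner_ltE c d : corner_lt c d =
  (cpos c < cpos d) || (cpos c == cpos d) && (cidx c < cidx d)%N.
Proof.
rewrite /corner_lt /cpos /cidx; case: (val c) => i k; case: (val d) => j l /=.
rewrite ltEprodlexi /= ltEnat /=; lia.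
Qed.

Lemma corner_inj c d : cpos c = cpos d -> cidx c = cidx d -> c = d.
Proof.
by move=> pcd icd; apply/val_inj/eqP; rewrite -pair_eqE/=; apply/andP; split; apply/eqP.
Qed.

Lemma corner_ltNge c d : corner_lt c d = false -> corner_lt d c \/ c = d.
Proof.
rewrite !corner_ltE => h.
have [/eqP pcd|pcd] := boolP (cpos c == cpos d); last by left; lia.
have [/eqP icd|icd] := boolP (cidx c == cidx d); last by left; lia.
by right; apply: corner_inj.
Qed.

Lemma corner_of i k : DS b i -> (k < size (contour (tb_tree b i)))%N ->
  exists c, cpos c = i /\ cidx c = k.
Proof.
move=> di ki; have h : DS b (i, k).1 && ((i, k).2 < size (contour (tb_tree b (i, k).1)))%N.
  by rewrite /= di.
by exists (exist _ ((i, k) : int *l nat) h).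
Qed.

Lemma walk_step j : x j = x (j - 1) - 1 \/ x j = x (j - 1) + 1.
Proof. by have := tb_step b (j - 1); rewrite subrK; lia. Qed.

Lemma root_label_tb i : DS b i -> root_label (tb_tree b i) = x i.
Proof. by move=> /tb_treeP/andP[_ /eqP]. Qed.

Lemma last_corner i : DS b i ->
  exists c, cpos c = i /\ clabel c = x i /\
    forall d, cpos d = i -> corner_lt c d = false.
Proof.
move=> di; set s := contour (tb_tree b i).
have s0 : (0 < size s)%N by exact: contour_gt0.
have [|c [ci ck]] := @corner_of i (size s).-1 di; first by rewrite -/s; lia.
exists c; split=> //; split.
  rewrite clabelE ci ck -{1}(size_map (fun u => root_label (subtree (tb_tree b i) u))).
  by rewrite nth_last contour_labels_last root_label_tb.
move=> d di'; have := cidxP d; rewrite corner_ltE ci ck di' -/s; lia.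
Qed.

(* A run of up-steps follows the last down-step before [g], so labels read along
   the contour can only drop by one at a time, also across phantom vertices. *)
Lemma corner_before_gap c g : cpos c < g -> exists e,
  [/\ corner_lt e c = false, cpos e < g & clabel e <= x g + 1].
Proof.
move=> cg; have [n gE] : exists n : nat, g = cpos c + 1 + n%:Z.
  by exists (absz (g - cpos c - 1)%R); lia.
elim: n g cg gE => [|n IH] g cg gE.
  have [e [ec [le lst]]] := last_corner (cposP c).
  exists e; split; [exact: lst|lia|].
  rewrite le gE addr0; have := cposP c; rewrite /DS /down_steps => /eqP ->; lia.
have [dg|ug] := boolP (DS b (g - 1)).
  have [e [eg [le _]]] := last_corner dg.
  exists e; split; [rewrite corner_ltE; lia|lia|].
  rewrite le; move: dg; rewrite /DS /down_steps subrK => /eqP ->; lia.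
have [|| e [ec eg le]] := IH (g - 1); [lia|lia|].
exists e; split=> //; first lia.
have := tb_step b (g - 1); move: ug; rewrite /DS /down_steps subrK => /eqP; lia.
Qed.

(** The witness is the last down-step before [j], after which the bridge only rises up to [j]. *)
Lemma down_step_between i j : i < j -> x j < x i ->
  exists m, [/\ i <= m, DS b m & x m <= x j + 1].
Proof.
move=> ij; have [n jE] : exists n : nat, j = i + 1 + n%:Z.
  by exists (absz (j - i - 1)%R); lia.
elim: n j ij jE => [|n IH] j ij jE xji;
  have [dj|uj] := walk_step j.
- by exists (j - 1); rewrite /DS /down_steps subrK dj eqxx; split=> //; lia.
- by move: xji; rewrite uj (_ : j - 1 = i); lia.
- by exists (j - 1); rewrite /DS /down_steps subrK dj eqxx; split=> //; lia.
- have [|||m [im dm xm]] := IH (j - 1); [lia|lia|lia|].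
  by exists m; split=> //; lia.
Qed.

(** The witness is the preceding corner of the same tree or, when [d] opens its tree, a corner of an
    earlier tree. *)
Lemma pred_corner c d : corner_lt c d -> exists e,
  [/\ corner_lt e c = false, corner_lt e d & clabel e <= clabel d + 1].
Proof.
move=> cd.
case kE : (cidx d) => [|k].
  have [|e [ec ed le]] := @corner_before_gap c (cpos d).
    by move: cd; rewrite corner_ltE; lia.
  exists e; split=> //; first by rewrite corner_ltE ed.
  suff -> : clabel d = x (cpos d) by [].
  rewrite clabelE kE -(root_label_tb (cposP d)).
  by case: (tb_tree b (cpos d)) => r ts; rewrite contour_labelsE.
have := cidxP d; rewrite kE => kd.
have [e [ei ek]] := corner_of (cposP d) (ltnW kd).
exists e; split.
- by move: cd; rewrite !corner_ltE; lia.
- by rewrite corner_ltE; lia.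
- have wd : well_labelled (tb_tree b (cpos d)).
    by case/andP: (tb_treeP (cposP d)).
  have := contour_labels_step wd kd.
  by rewrite !clabelE ei ek kE; lia.
Qed.

(** The order on corners need not be well-founded, but beyond [c] positions are bounded below: the
    position is minimised first, then the index in the contour. *)
Lemma first_corner c d (Q : real_corner b -> Prop) : corner_lt c d -> Q d ->
  exists e, [/\ corner_lt c e, Q e, corner_lt d e = false &
    forall d', corner_lt c d' -> corner_lt d' e -> ~ Q d'].
Proof.
move=> cd Qd.
pose S n := `[< exists e, [/\ corner_lt c e, Q e & cpos e = cpos c + n%:Z] >].
have exS : exists n, S n.
  exists `|cpos d - cpos c|%N; apply/asboolP; exists d; split=> //.
  by move: cd; rewrite corner_ltE; lia.
case: (ex_minnP exS) => n /asboolP[e1 [ce1 Qe1 e1n]] nmin.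
pose U k := `[< exists e, [/\ corner_lt c e, Q e, cpos e = cpos c + n%:Z & cidx e = k] >].
have exU : exists k, U k by exists (cidx e1); apply/asboolP; exists e1.
case: (ex_minnP exU) => k /asboolP[e [ce Qe en ek]] kmin.
have first d' : corner_lt c d' -> corner_lt d' e -> ~ Q d'.
  move=> cd' d'e Qd'.
  have := nmin `|cpos d' - cpos c|%N; have cd'' : cpos c <= cpos d'.
    by move: cd'; rewrite corner_ltE; lia.
  move=> /(_ _)/wrap[]; first by apply/asboolP; exists d'; split=> //; lia.
  move=> nd'; have pd' : cpos d' = cpos c + n%:Z.
    by move: d'e; rewrite corner_ltE; lia.
  have /kmin : U (cidx d') by apply/asboolP; exists d'.
  by move: d'e; rewrite corner_ltE; lia.
exists e; split=> //; apply/negP => de; exact: (first d).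
Qed.

(** The first later corner with a label below that of [c] has label exactly [clabel c - 1], since
    labels drop by at most one at a time; hence it is the successor. *)
Lemma first_drop c d : corner_lt c d -> clabel d < clabel c ->
  exists2 e, successor c e & corner_lt d e = false.
Proof.
move=> cd ld.
have [e [ce le de emin]] := @first_corner c d (fun d => clabel d < clabel c) cd ld.
have [f [fc fe lf]] := pred_corner ce.
have lfc : clabel c <= clabel f.
  have [cf|->//] := corner_ltNge fc.
  by rewrite leNgt; apply/negP; exact: emin.
exists e => //; split=> //; first by move: le; lia.
by move=> d' cd' ld'; apply/negP => d'e; apply: (emin d') => //; lia.
Qed.

Lemma successor_between c e d : successor c e -> corner_lt c d -> corner_lt d e ->
  clabel c <= clabel d.
Proof.
move=> [ce le emin] cd de; rewrite leNgt; apply/negP => ld.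
have [f [cf lf fmin] df] := first_drop cd ld.
have := emin f cf lf; apply/negP/negPn; move: df de; rewrite !corner_ltE; lia.
Qed.

(** * Walks in the graph and cuts separating vertices *)

Let G := Phi b.

Lemma mwalk_cat n m (u v w : mvertex G) :
  mwalk n u v -> mwalk m v w -> mwalk (n + m) u w.
Proof.
elim: n u => [|n IH] u /=; first by move=> ->.
by move=> [t ut tv] vw; exists t => //; exact: IH.
Qed.

Lemma madj_sym (u v : mvertex G) : madj u v -> madj v u.
Proof. by move=> [e h]; exists e; case: h; [right|left]. Qed.

Lemma mwalk_sym n (u v : mvertex G) : mwalk n u v -> mwalk n v u.
Proof.
elim: n u => [|n IH] u; first by move=> /= ->.
move=> [t ut tv]; rewrite -addn1; apply: mwalk_cat (IH _ tv) _ => /=.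
by exists u => //; exact: madj_sym.
Qed.

Lemma successor_madj c e : successor c e ->
  madj (corner_vertex c : mvertex G) (corner_vertex e).
Proof.
move=> ce; exists (exist (fun p => successor p.1 p.2) (c, e) ce).
by left.
Qed.

Lemma madj_successor (u v : mvertex G) : madj u v -> exists c e,
  successor c e /\ ((corner_vertex c = u /\ corner_vertex e = v) \/
                    (corner_vertex c = v /\ corner_vertex e = u)).
Proof. by move=> [[[c e] /= ce] h]; exists c, e. Qed.

(** Each edge changes the label by one. This lower bound on lengths makes successor chains
    geodesics. *)
Lemma mwalk_label n (u v : mvertex G) :
  mwalk n u v -> vlabel u - vlabel v <= n%:Z.
Proof.
elim: n u => [|n IH] u /=; first by move=> ->; lia.
move=> [t /madj_successor[c [e [[_ le _] h]]] /IH].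
suff : `|vlabel u - vlabel t| <= 1 by lia.
by case: h => -[<- <-]; rewrite -!/(clabel _) le; lia.
Qed.

(** The hypothesis makes [e] the first corner from [c] on with label at most [clabel e]. A successor
    never jumps over such a corner, so the chain descends to [e] itself. *)
Lemma successor_chain c e : corner_lt c e ->
  (forall d, corner_lt d c = false -> corner_lt d e -> clabel e < clabel d) ->
  mwalk `|clabel c - clabel e|%N (corner_vertex c : mvertex G) (corner_vertex e).
Proof.
have [n nE] : exists n, (`|clabel c - clabel e| <= n)%N by exists `|clabel c - clabel e|%N.
elim: n c nE => [|n IH] c nE ce ec.
  suff : clabel e < clabel c by lia.
  by apply: ec => //; rewrite corner_ltE; lia.
have lec : clabel e < clabel c by apply: ec => //; rewrite corner_ltE; lia.
have [f [cf lf fmin] ef] := first_drop ce lec.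
have -> : `|clabel c - clabel e|%N = (1 + `|clabel f - clabel e|)%N by lia.
have cf' : successor c f by split.
apply: (@mwalk_cat _ _ _ (corner_vertex f)).
  by exists (corner_vertex f) => //; exact: successor_madj.
have [fe|<-] := corner_ltNge ef; last by rewrite subrr.
apply: IH => //; first lia.
by move=> d df de; apply: ec => //; move: df cf; rewrite !corner_ltE; lia.
Qed.

Lemma vertex_corner (v : mvertex G) : exists c, corner_vertex c = v.
Proof.
case: v => -[i u] /= h; have /andP[di tu] := h; have cu := mem_contour tu.
have [|c [ci ck]] := @corner_of i (index u (contour (tb_tree b i))) di.
  by rewrite index_mem.
exists c; apply/val_inj => /=; move: ci ck; rewrite /cpos /cidx => -> ->.
by rewrite nth_index.
Qed.

Definition vpos (v : mvertex G) : int := (val v).1.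

Lemma vpos_corner c : vpos (corner_vertex c) = cpos c.
Proof. by []. Qed.

(** Some corner from [c] on and before [g] has label at most [x g + 1], and no label under the edge
    is below that of [c]. *)
Lemma cross_label c e g : successor c e -> cpos c < g -> g <= cpos e ->
  clabel e <= x g.
Proof.
move=> ce cg ge; have [f [fc fg lf]] := corner_before_gap cg.
have [_ -> _] := ce.
suff : clabel c <= clabel f by lia.
have [cf|->//] := corner_ltNge fc.
by apply: successor_between ce cf _; rewrite corner_ltE; lia.
Qed.

(** Successors lie later in the contour, so these pairs describe all edges jumping over [g]. By
    [mwalk_label] the walk required here is a geodesic. *)
Definition separates g (u : mvertex G) := forall c e,
  successor c e -> cpos c < g -> g <= cpos e ->
  mwalk `|vlabel u - clabel e|%N u (corner_vertex e) /\ clabel e <= vlabel u.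

(** Between [u] and [g] labels exceed [x g], hence [clabel e]; between [g] and [e] they are at least
    [clabel c]. So [successor_chain] applies. *)
Lemma separates_right p g (u : mvertex G) : p <= vpos u -> vpos u < g ->
  (forall d, p <= cpos d -> cpos d < g -> x g < clabel d) -> separates g u.
Proof.
move=> pu ug pg c e ce cg ge; have leg := cross_label ce cg ge.
have [d du] := vertex_corner u; rewrite -du -/(clabel d) in pu ug *.
rewrite vpos_corner in pu ug.
split; last by have := pg d pu ug; lia.
apply: successor_chain; first by rewrite corner_ltE; lia.
move=> f fd fe; have [fg|gf] := ltP (cpos f) g.
  by apply: le_lt_trans leg _; apply: pg => //; move: fd; rewrite corner_ltE; lia.
have := successor_between ce _ fe; have [_ -> _] := ce.
by move=> /(_ _)/wrap[]; [rewrite corner_ltE; lia|lia].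
Qed.

(** The low label of [e] forces it beyond [q], hence after [u]. All corners from [u] to [e] then lie
    under the edge, where labels are at least [clabel c]. *)
Lemma separates_left q g (u : mvertex G) : g <= vpos u -> vpos u <= q ->
  (forall d, g <= cpos d -> cpos d <= q -> x g < clabel d) -> separates g u.
Proof.
move=> gu uq gq c e ce cg ge; have leg := cross_label ce cg ge.
have [d du] := vertex_corner u; rewrite -du -/(clabel d) in gu uq *.
rewrite vpos_corner in gu uq.
have ld := gq d gu uq.
have qe : q < cpos e by rewrite ltNge; apply/negP => eq; have := gq e ge eq; lia.
split; last lia.
apply: successor_chain; first by rewrite corner_ltE; lia.
move=> f fd fe; have := successor_between ce _ fe; have [_ -> _] := ce.
move=> /(_ _)/wrap[]; last lia.
by move: fd; rewrite !corner_ltE; lia.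
Qed.

Lemma mwalk_cross g n (u z : mvertex G) : (vpos u < g) != (vpos z < g) ->
  mwalk n u z -> exists c e, exists n1 n2, [/\ successor c e, cpos c < g, g <= cpos e,
    (n1 + n2 = n)%N &
    mwalk n1 u (corner_vertex e) /\ mwalk n2 (corner_vertex e : mvertex G) z].
Proof.
elim: n u => [|n IH] u /= uz; first by move=> uz'; rewrite uz' eqxx in uz.
move=> [t ut tz].
have [tg|tg] := boolP ((vpos t < g) == (vpos u < g)).
  have [|c [e [n1 [n2 [ce cg ge n12 [w1 w2]]]]]] := IH t _ tz.
    by rewrite (eqP tg).
  exists c, e, n1.+1, n2; split=> //; first by rewrite addSn n12.
  by split=> //; exists t.
have [c [e [ce h]]] := madj_successor ut.
have pce : cpos c <= cpos e by case: ce => + _ _; rewrite corner_ltE; lia.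
(* The first edge of the walk jumps over [g], in either direction: the vertex of [e] is reached
   after one step, or is the starting vertex. *)
exists c, e; case: h => -[cu et].
  exists 1%N, n; rewrite -cu -et !vpos_corner in tg.
  split=> //; [lia|lia|]; split; last by rewrite et.
  by exists t => //=; rewrite et.
exists 0%N, n.+1; rewrite -cu -et !vpos_corner in tg.
split=> //; [lia|lia|]; split; first by rewrite /= et.
by rewrite et; exists t.
Qed.

(** The walk is kept after the vertex of [e]. Before it, a part of length at least
    [vlabel u - clabel e] is replaced by the geodesic from [v]. *)
Lemma separates_walk g n (u v z : mvertex G) : separates g u -> separates g v ->
  (vpos u < g) != (vpos z < g) -> mwalk n u z ->
  exists m, mwalk m v z /\ m%:Z <= n%:Z + (vlabel v - vlabel u).
Proof.
move=> su sv uz /(mwalk_cross uz)[c [e [n1 [n2 [ce cg ge <- [w1 w2]]]]]].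
have [wv lv] := sv _ _ ce cg ge.
exists (`|vlabel v - clabel e| + n2)%N; split; first exact: mwalk_cat wv w2.
by have := mwalk_label w1; rewrite -/(clabel e); lia.
Qed.

Lemma labels_bounded i j : exists M, forall d, i <= cpos d -> cpos d <= j ->
  M < clabel d.
Proof.
have [ji|ij] := ltP j i; first by exists 0 => d; lia.
have [n ->] : exists n : nat, j = i + n%:Z by exists `|j - i|%N; lia.
have one k : exists M, forall d, cpos d = k -> M < clabel d.
  have [M hM] : exists M, {in contour_labels (tb_tree b k), forall a, M < a}.
    elim: (contour_labels _) => [|a s [M hM]]; first by exists 0.
    exists (Order.min M (a - 1)) => a'; rewrite in_cons => /predU1P[->|/hM]; lia.
  exists M => d dk; apply: hM; rewrite clabelE dk mem_nth// size_map -dk.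
  exact: cidxP.
elim: n => [|n [M hM]].
  by have [M hM] := one i; exists M => d ? ?; apply: hM; lia.
have [M' hM'] := one (i + n.+1%:Z); exists (Order.min M M') => d id dj.
have [dn|dn] := eqVneq (cpos d) (i + n.+1%:Z); first by have := hM' d dn; lia.
by have := hM d id; lia.
Qed.

(** With [M] below all labels between the two corners, both successor chains pass through the first
    corner after [c] with label at most [M]. *)
Lemma corners_connected c c' :
  (forall i m, exists d, i <= cpos d /\ clabel d <= m) ->
  exists n, mwalk n (corner_vertex c : mvertex G) (corner_vertex c').
Proof.
move=> inf; wlog cc' : c c' / corner_lt c c'.
  move=> H; have [cc'|] := boolP (corner_lt c c'); first exact: H.
  move=> /negbTE/corner_ltNge[c'c|<-]; last by exists 0%N.
  by have [n /mwalk_sym w] := H _ _ c'c; exists n.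
have [M hM] := labels_bounded (cpos c) (cpos c').
have [d [dp dM]] := inf (cpos c' + 1) M.
have pcc' : cpos c <= cpos c' by move: cc'; rewrite corner_ltE; lia.
have cd : corner_lt c d by rewrite corner_ltE; lia.
have [e [ce eM de emin]] := @first_corner c d (fun d => clabel d <= M) cd dM.
have c'e : corner_lt c' e.
  rewrite corner_ltE; have [ec'|] := leP (cpos e) (cpos c'); last lia.
  by have := hM e _ ec'; move: ce; rewrite corner_ltE; lia.
have big d' : corner_lt d' c = false -> corner_lt d' e -> M < clabel d'.
  move=> /corner_ltNge[cd' d'e|-> _]; last by apply: hM; lia.
  by rewrite ltNge; apply/negP; exact: emin.
exists (`|clabel c - clabel e| + `|clabel c' - clabel e|)%N.
apply: (@mwalk_cat _ _ _ (corner_vertex e)).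
  by apply: successor_chain => // d' h1 h2; have := big d' h1 h2; lia.
apply: mwalk_sym; apply: successor_chain => // d' h1 h2.
have /(_ _ h2) := big d'.
by move: h1 cc'; rewrite !corner_ltE; lia.
Qed.

Lemma dgr_min (R : realType) n (u v : mvertex G) : mwalk n u v ->
  exists m, [/\ mwalk m u v, dgr R u v = (m%:R)%:E &
    forall k, mwalk k u v -> (m <= k)%N].
Proof.
move=> w; have ex : exists n, `[< mwalk n u v >] by exists n; exact/asboolP.
case: (ex_minnP ex) => m /asboolP wm mmin; exists m.
have mmin' k : mwalk k u v -> (m <= k)%N by move=> wk; apply/mmin/asboolP.
split=> //; apply/eqP; rewrite eq_le; apply/andP; split.
  by apply: ereal_inf_lbound; exists m.
apply: le_ereal_inf_tmp => _ [k /= wk <-]; by rewrite lee_fin ler_nat mmin'.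
Qed.

(** [separates_walk] in both directions, applied to shortest walks, gives two opposite
    inequalities. *)
Lemma dgr_separated (R : realType) g n (u v z : mvertex G) :
  separates g u -> separates g v ->
  (vpos u < g) != (vpos z < g) -> (vpos v < g) != (vpos z < g) -> mwalk n u z ->
  (dgr R u z - dgr R v z = ((vlabel u - vlabel v)%:~R)%:E)%E.
Proof.
move=> su sv uz vz w.
have [m [wm -> mmin]] := dgr_min R w.
have [k [wk kE]] := separates_walk su sv uz wm.
have [k' [wk' -> kmin]] := dgr_min R wk.
have [m' [wm' mE]] := separates_walk sv su vz wk'.
have mm' := mmin _ wm'; have kk' := kmin _ wk.
rewrite -EFinB; congr EFin.
have -> : vlabel u - vlabel v = m%:Z - k'%:Z :> int by lia.
by rewrite rmorphB.
Qed.

(** Hence the vertices outside a strip of positions form a neighbourhood of infinity. *)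
Lemma finite_vertices_between i j : finite_set [set v : mvertex G | i <= vpos v /\ vpos v < j].
Proof.
have [ji|ij] := ltP j i.
  by apply: (sub_finite_set _ (finite_set0 _)) => v /= [iv vj]; exfalso; lia.
have [n ->] : exists n : nat, j = i + n%:Z by exists `|j - i|%N; lia.
elim: n => [|n IH].
  by apply: (sub_finite_set _ (finite_set0 _)) => v /= [iv vj]; exfalso; lia.
set k := i + n%:Z in IH *.
apply: (sub_finite_set (B := [set v : mvertex G | i <= vpos v /\ vpos v < k] `|`
   [set v : mvertex G | vpos v = k])) => [v /= [iv vj]|].
  by have [vk|kv] := ltP (vpos v) k; [left|right; rewrite /k in kv *; lia].
rewrite finite_setU; split=> //.
apply: (sub_finite_set (B := [set v : mvertex G |
    exists2 u, u \in contour (tb_tree b k) & val v = (k, u)])).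
  move=> v /= vk; have [d dv] := vertex_corner v; rewrite -dv in vk *.
  exists (val (corner_vertex d)).2; last by rewrite -vk -surjective_pairing.
  by rewrite -vk /= mem_nth// cidxP.
elim: (contour _) => [|u s IHs].
  by apply: (sub_finite_set _ (finite_set0 _)) => v /= [].
apply: (sub_finite_set (B := [set v : mvertex G | val v = (k, u)] `|`
   [set v : mvertex G | exists2 u, u \in s & val v = (k, u)])) => [v /= [u']|].
  by rewrite in_cons => /predU1P[->|us] vE; [left|right; exists u'].
rewrite finite_setU; split=> //.
have [[v0 v0E]|nov] := pselect (exists v : mvertex G, val v = (k, u)).
  apply: (sub_finite_set (B := [set v0])); last exact: finite_set1.
  by move=> v vE; apply: val_inj; exact: etrans vE (esym v0E).
apply: (sub_finite_set _ (finite_set0 _)) => v /= vE; apply: nov; by exists v.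
Qed.

(** This is the deterministic half: once [z] is beyond a low enough cut on either side, the
    difference of distances equals the difference of labels. *)
Lemma dgr_diff_cvg (R : realType) :
  (forall K : nat, exists n k : nat, [/\ (K <= k)%N, x n%:Z = - k%:Z &
    forall d, 0 <= cpos d -> cpos d < n%:Z -> - k%:Z < clabel d]) ->
  (forall K : nat, exists n k : nat, [/\ (K <= k)%N, x (- n%:Z) = - k%:Z &
    forall d, - n%:Z <= cpos d -> cpos d < 0 -> - k%:Z < clabel d]) ->
  forall u v : mvertex G,
    (dgr R u z - dgr R v z)%E @[z --> vinfty G]
      --> ((vlabel u - vlabel v)%:~R : R)%:E.
Proof.
move=> hr hl u v.
(* Level [- k] is not reached before [k] steps, so low cuts are also far away. *)
have xbound n : `|x n%:Z| <= n%:Z /\ `|x (- n%:Z)| <= n%:Z.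
  elim: n => [|n [IH1 IH2]]; first by rewrite oppr0 (tb_walk0 b).
  have := tb_step b n%:Z; have := tb_step b (- n.+1%:Z).
  have -> : - n.+1%:Z + 1 = - n%:Z by lia.
  have -> : n%:Z + 1 = n.+1%:Z by lia.
  by lia.
have inf i m : exists d, i <= cpos d /\ clabel d <= m.
  have [i' [i'0 ii' i'i]] : exists i', [/\ 0 <= i', i <= i' & i' <= `|i|].
    by exists (Order.max i 0); split; lia.
  have [n [k [Kk xn _]]] := hr (`|i| + `|m| + 2)%N.
  have [n0 _] := xbound n; have [xi' _] := xbound `|i'|%N.
  have [||j [ij dj lj]] := @down_step_between i' n%:Z; [lia| |].
    by move: xi'; rewrite (_ : `|i'|%N%:Z = i' :> int); lia.
  by have [d [dj' [ld _]]] := last_corner dj; exists d; lia.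
have conn z : exists n, mwalk n u z.
  have [c <-] := vertex_corner u; have [c' <-] := vertex_corner z.
  exact: corners_connected.
pose p := Order.min 0 (Order.min (vpos u) (vpos v)).
pose q := Order.max 0 (Order.max (vpos u) (vpos v)).
have [M hM] := labels_bounded p q.
(* The constant puts level [- k] below [M] and, by [xbound], position [n] beyond [q]. *)
have [n [k [Kk xn nl]]] := hr (`|q| + `|M| + 1)%N.
have [n' [k' [Kk' xn' nl']]] := hl (`|p| + `|M| + 1)%N.
have [n0 _] := xbound n; have [_ n'0] := xbound n'.
have sr w : p <= vpos w -> vpos w <= q -> separates n%:Z w.
  move=> pw wq; apply: (@separates_right p) => //; first lia.
  move=> d pd dn; have [dq|dq] := leP (cpos d) q; first by have := hM d pd dq; lia.
  by have := nl d; lia.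
have sl w : p <= vpos w -> vpos w <= q -> separates (- n'%:Z) w.
  move=> pw wq; apply: (@separates_left q) => //; first lia.
  move=> d pd dn; have [dq|dq] := leP p (cpos d); first by have := hM d dq dn; lia.
  by have := nl' d; lia.
move=> U /= Ul; rewrite /vinfty /=.
apply: (sub_finite_set _ (finite_vertices_between (- n'%:Z) n%:Z)) => z /= Uz.
have [m w] := conn z.
apply: contrapT => out; apply: Uz => /=.
suff -> : (dgr R u z - dgr R v z = ((vlabel u - vlabel v)%:~R)%:E)%E.
  exact: (nbhs_singleton Ul).
have [zn|zn] := ltP (vpos z) (- n'%:Z).
  by apply: (@dgr_separated R (- n'%:Z) m) => //; [apply: sl|apply: sl| |]; lia.
by apply: (@dgr_separated R n%:Z m) => //; [apply: sr|apply: sr| |]; lia.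
Qed.

End Corners.

(** * Renewal levels of an i.i.d. sequence of letters *)

Section Words.
Variables (E : eqType) (ok : nat -> E -> bool) (down : pred E).

(** [h] is the height above a target level. The word must reach that level for the first time at its
    end, each letter being admissible at the height where it is read. *)
Fixpoint hits (h : nat) (s : seq E) : bool :=
  if s is e :: s' then
    [&& (0 < h)%N, ok h e & hits (if down e then h.-1 else h.+1) s']
  else h == 0%N.

Lemma hits0 s : hits 0 s = (s == [::]).
Proof. by case: s. Qed.

Hypothesis ok_mono : forall h k e, ok h e -> ok (h + k) e.

(** This is the renewal property: [u] uses up [j] levels, and by [ok_mono] its letters stay
    admissible when started [k] levels higher. *)
Lemma hits_cat j u k v : hits j u -> hits (j + k) (u ++ v) = hits k v.
Proof.
elim: u j => [|e u IH] j /=; first by move=> /eqP ->.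
move=> /and3P[j0 oke hu]; rewrite addn_gt0 j0 ok_mono//= -(IH _ hu).
by case: (down e); [rewrite -!subn1 addnBAC|].
Qed.

Lemma hits_leq j u k v : hits j u -> hits k (u ++ v) -> (j <= k)%N.
Proof.
elim: u j k => [|e u IH] j k /=; first by move=> /eqP ->.
move=> /and3P[j0 _ hu] /and3P[k0 _ hv]; have := IH _ _ hu hv.
by case: (down e); lia.
Qed.

Lemma hits_inj j k u : hits j u -> hits k u -> j = k.
Proof.
move=> hj hk; apply/eqP; rewrite eqn_leq.
by rewrite (@hits_leq j u k [::]) ?cats0// (@hits_leq k u j [::]) ?cats0.
Qed.

End Words.

(** * A discrete maximum principle *)

Section Maximum.
Variable R : realType.

(** The increments are nondecreasing, so a positive one would force linear growth beyond [M]. Thus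
    [f] never increases from its value zero, and it is nonnegative. *)
Lemma bounded_convex_eq0 (f : nat -> R) (M : R) : f 0%N = 0 ->
  (forall h, 0 <= f h <= M) -> (forall h, 2 * f h.+1 <= f h + f h.+2) ->
  forall h, f h = 0.
Proof.
move=> f0 fM cvx.
have inc h k : f h.+1 - f h <= f (h + k).+1 - f (h + k)%N.
  elim: k => [|k IH]; first by rewrite addn0.
  by rewrite addnS; have := cvx (h + k)%N; lra.
have lin h k : f h + (f h.+1 - f h) *+ k <= f (h + k)%N.
  elim: k => [|k IH]; first by rewrite mulr0n addr0 addn0.
  by rewrite addnS mulrSr; have := inc h k; lra.
have noninc h : f h.+1 <= f h.
  rewrite leNgt; apply/negP => fh.
  have d0 : 0 < f h.+1 - f h by lra.
  pose k := Num.bound (M / (f h.+1 - f h)).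
  have := lin h k; have /andP[_ +] := fM (h + k)%N; have /andP[+ _] := fM h.
  have : M < (f h.+1 - f h) *+ k.
    rewrite -mulr_natr -ltr_pdivrMl// mulrC archi_boundP// divr_ge0//; last exact: ltW.
    by have := fM 0%N; lra.
  by lra.
elim=> [//|h IH]; apply/eqP; rewrite eq_le; have /andP[-> _] := fM h.+1.
by rewrite andbT -IH noninc.
Qed.

(** As [a] and [b] are at most one half, the positive part of [f - g] is a bounded convex sequence
    vanishing at zero. *)
Lemma subharmonic_le (f g a b : nat -> R) (M : R) :
  (forall h, 0 <= a h <= 2^-1) -> (forall h, 0 <= b h <= 2^-1) ->
  f 0%N <= g 0%N -> (forall h, f h <= M) -> (forall h, 0 <= g h) ->
  (forall h, f h.+1 <= a h * f h + b h * f h.+2) ->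
  (forall h, a h * g h + b h * g h.+2 <= g h.+1) ->
  forall h, f h <= g h.
Proof.
move=> a01 b01 fg0 fM g0 fsub gsup h.
pose e h := Num.max (f h - g h) 0.
have e0 k : 0 <= e k by rewrite le_max lexx orbT.
have fe k : f k - g k <= e k by rewrite le_max lexx.
suff : e h = 0 by have := fe h; lra.
apply: (@bounded_convex_eq0 e (Num.max M 0)).
- by apply/max_idPr; rewrite subr_le0.
- move=> k; rewrite e0 ge_max !le_max lexx orbT andbT andTb.
  by apply/orP; left; have := fM k; have := g0 k; lra.
- move=> k; have := fsub k; have := gsup k.
  have := a01 k; have := b01 k; have := fe k; have := fe k.+2.
  have := e0 k; have := e0 k.+2; move: (e k) (e k.+2) => x y x0 y0 fx fy.
  move=> /andP[b0 b1] /andP[a0 a1] gs fs.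
  suff : e k.+1 <= 2^-1 * (x + y) by lra.
  rewrite ge_max; apply/andP; split; last by lra.
  by nra.
Qed.

End Maximum.

(** * Laws and independence of countable-valued variables *)

Section DiscreteLaws.
Context {d : measure_display} {Omega : measurableType d} {R : realType}.
Variable P : probability Omega R.

Lemma discrete_rv_comp (E E' : Type) (U : Omega -> E) (f : E -> E') :
  discrete_rv U -> discrete_rv (f \o U).
Proof. by move=> mU A; rewrite comp_preimage; exact: mU. Qed.

Lemma discrete_rv_pair (E E' : countType) (U : Omega -> E) (V : Omega -> E') :
  discrete_rv U -> discrete_rv V -> discrete_rv (fun w => (U w, V w)).
Proof.
move=> mU mV A.
rewrite (_ : _ @^-1` A = \bigcup_(u : E)
    (U @^-1` [set u] `&` V @^-1` [set v | A (u, v)])); last first.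
  by apply/seteqP; split => w /=; [exists (U w)|move=> [u _ [<-]]].
by apply: countable_bigcupT_measurable => // u; apply: measurableI.
Qed.

(** Both events are countable unions over [S] of disjoint atoms, [phi] being injective there, so the
    relation between atoms can be summed. *)
Lemma law_transfer (E E' : countType) (U : Omega -> E) (V : Omega -> E')
    (C C' : set Omega) (S : set E) (phi : E -> E') (c : R) :
  discrete_rv U -> discrete_rv V -> measurable C -> measurable C' ->
  {in S &, injective phi} ->
  (forall u, S u ->
    P (C' `&` V @^-1` [set phi u]) = (c%:E * P (C `&` U @^-1` [set u]))%E) ->
  P (C' `&` V @^-1` (phi @` S)) = (c%:E * P (C `&` U @^-1` S))%E.
Proof.
move=> mU mV mC mC' injphi PE.
pose F (X : E -> set Omega) n := if pickle_inv n is Some u then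
  if `[< S u >] then X u else set0 else set0.
have mF X : (forall u, measurable (X u)) -> forall n, measurable (F X n).
  by move=> mX n; rewrite /F; case: pickle_inv => // u; case: ifP.
have FE X : \bigcup_n F X n = \bigcup_(u in S) X u.
  apply/seteqP; split => [w [n _]|w [u Su Xu]].
    rewrite /F; case: pickle_inv => // u; case: ifP => // /asboolP Su Xu.
    by exists u.
  by exists (pickle u) => //; rewrite /F pickleK_inv; case: asboolP.
have tF X : (forall u v w, S u -> S v -> X u w -> X v w -> u = v) ->
    trivIset setT (F X).
  move=> tX n m _ _ [w []]; rewrite /F.
  have := @pickle_invK E n; have := @pickle_invK E m.
  case: pickle_inv => // v <-; case: pickle_inv => // u <-.
  by case: asboolP => // Su Xu; case: asboolP => // Sv Xv; rewrite (tX u v w).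
have muX (T : countType) (U' : Omega -> T) (D : set Omega) (f : E -> T) :
    discrete_rv U' -> measurable D -> {in S &, injective f} ->
  P (D `&` U' @^-1` (f @` S)) =
    (\sum_(n <oo) P (F (fun u => D `&` U' @^-1` [set f u]) n))%E.
  move=> mU' mD injf; rewrite -measure_semi_bigcup.
  - rewrite FE; congr (P _); apply/seteqP; split => [w /= [Dw [u Su uw]]|].
      by exists u.
    by move=> w [u Su [Dw /= uw]]; split=> //; exists u.
  - by apply: mF => u; exact: measurableI.
  - apply: tF => u v w Su Sv [_ /= ->] [_ /= uv].
    by apply: injf; rewrite ?inE.
  - by apply: bigcupT_measurable; apply: mF => u; exact: measurableI.
have := muX _ U C id mU mC; rewrite image_id => ->; last by move=> ? ? _ _.
rewrite muX//.
rewrite -nneseriesZl//; apply: eq_eseriesr => n _; rewrite /F.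
case: pickle_inv => [u|]; last by rewrite !measure0 mule0.
by case: asboolP => [Su|_]; [exact: PE|rewrite !measure0 mule0].
Qed.

Lemma independent_of_atoms (E : countType) (U V : Omega -> E) (C : set Omega)
    (S : set E) : discrete_rv U -> discrete_rv V -> measurable C ->
  (forall u, S u -> P (C `&` V @^-1` [set u]) = (P C * P (U @^-1` [set u]))%E) ->
  P (C `&` V @^-1` S) = (P C * P (U @^-1` S))%E.
Proof.
move=> mU mV mC PE.
have := @law_transfer E E U V setT C S id (fine (P C)) mU mV measurableT mC.
rewrite image_id fineK ?fin_num_measure// !setTI; apply; first by move=> ? ? _ _.
by move=> u Su; rewrite setTI PE.
Qed.

Section Sequence.
Variables (E : countType) (xi : nat -> Omega -> E) (mu : E -> R).
Hypothesis mxi : forall n, discrete_rv (xi n).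
Hypothesis xi_iid : forall a : seq E,
  P [set w | [seq xi i w | i <- iota 0 (size a)] = a] = (\prod_(e <- a) mu e)%:E.

Definition word m n w := [seq xi i w | i <- iota m n].

Lemma size_word m n w : size (word m n w) = n.
Proof. by rewrite size_map size_iota. Qed.

Lemma word_cat m n k w : word m (n + k) w = word m n w ++ word (m + n) k w.
Proof. by rewrite /word iotaD map_cat. Qed.

Lemma discrete_rv_word m n : discrete_rv (word m n).
Proof.
elim: n m => [|n IH] m; first by move=> A; rewrite preimage_cst; case: ifP.
exact: (discrete_rv_comp (fun p => p.1 :: p.2)
  (discrete_rv_pair (mxi m) (IH m.+1))).
Qed.

(** The law is prescribed for words read from index 0 only; the shifted word is reached through the
    concatenation of [a] and [b]. *)
Lemma word_atoms n m a b :
  P (word 0 n @^-1` [set a] `&` word n m @^-1` [set b]) =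
  (P (word 0 n @^-1` [set a]) * P (word 0 m @^-1` [set b]))%E.
Proof.
have [sa|sa] := eqVneq (size a) n; last first.
  have -> : word 0 n @^-1` [set a] = set0.
    by apply/seteqP; split => // w /= wa; move: sa; rewrite -wa size_word eqxx.
  by rewrite set0I !measure0 mul0e.
have [sb|sb] := eqVneq (size b) m; last first.
  have e k : word k m @^-1` [set b] = set0.
    by apply/seteqP; split => // w /= wb; move: sb; rewrite -wb size_word eqxx.
  by rewrite !e setI0 !measure0 mule0.
have iid c : P (word 0 (size c) @^-1` [set c]) = (\prod_(e <- c) mu e)%:E.
  exact: xi_iid.
rewrite -sa -sb !iid -EFinM -big_cat/= -iid; congr (P _).
apply/seteqP; split => w /=; rewrite size_cat word_cat add0n.
  by move=> [-> ->].
by move/eqP; rewrite eqseq_cat ?size_word// => /andP[/eqP -> /eqP ->].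
Qed.

(** Atoms are replaced by sets one word at a time. The factor with [word 0 m] expresses stationarity
    along with independence. *)
Lemma word_independent n m (S S' : set (seq E)) :
  P (word 0 n @^-1` S `&` word n m @^-1` S') =
  (P (word 0 n @^-1` S) * P (word 0 m @^-1` S'))%E.
Proof.
have mw i j := @discrete_rv_word i j.
apply: independent_of_atoms; [exact: mw|exact: mw|exact: mw|move=> b _].
rewrite setIC muleC.
have mb i : measurable (word i m @^-1` [set b]) by exact: mw.
have := @law_transfer _ _ (word 0 n) (word 0 n) setT (word n m @^-1` [set b])
  S id (fine (P (word 0 m @^-1` [set b]))).
rewrite image_id fineK ?fin_num_measure// !setTI.
by apply=> // a _; rewrite setTI setIC word_atoms muleC.
Qed.

End Sequence.

End DiscreteLaws.

(** * Almost sure recurrence of the renewal levels *)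

Section Renewal.
Context {d : measure_display} {Omega : measurableType d} {R : realType}.
Variable P : probability Omega R.
Variables (E : countType) (xi : nat -> Omega -> E) (mu : E -> R).
Hypothesis mxi : forall n, discrete_rv (xi n).
Hypothesis xi_iid : forall a : seq E,
  P [set w | [seq xi i w | i <- iota 0 (size a)] = a] = (\prod_(e <- a) mu e)%:E.
Variables (ok : nat -> E -> bool) (down : pred E).
Hypothesis ok_mono : forall h k e, ok h e -> ok (h + k) e.

Local Notation hits := (hits ok down).
Local Notation word := (word xi).
Local Notation hit n h := (word 0 n @^-1` [set s | hits h s]).

Let mword m n (S : set (seq E)) : measurable (word m n @^-1` S).
Proof. exact: discrete_rv_word. Qed.

Lemma hit_trivIset h : trivIset setT (fun n => hit n h).
Proof.
move=> n m _ _ [w /= []]; wlog nm : n m / (n <= m)%N.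
  move=> H hn hm; have [nm|/ltnW mn] := leqP n m; first exact: H.
  by apply: esym; exact: H.
move=> hn; have [k ->] : exists k, m = (n + k)%N by exists (m - n)%N; lia.
rewrite word_cat -[h]addn0 hits_cat// hits0 -size_eq0 size_word => /eqP ->.
by rewrite addn0.
Qed.

Definition no_renewal m : set Omega :=
  [set w | forall i k, (0 < i)%N -> ~~ hits k (word m i w)].

Definition no_renewal_upto m K : set Omega := word m K @^-1`
  [set s | forall i k, (0 < i <= K)%N -> ~~ hits k (take i s)].

Lemma no_renewal_uptoE m K w : no_renewal_upto m K w <->
  forall i k, (0 < i <= K)%N -> ~~ hits k (word m i w).
Proof.
have te i : (i <= K)%N -> take i (word m K w) = word m i w.
  by move=> iK; rewrite /word -map_take take_iota (minn_idPl iK).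
split=> H i k /[dup] /andP[_ iK] iK'; first by rewrite -te//; exact: H.
by rewrite te//; exact: H.
Qed.

Lemma no_renewal_bigcap m : no_renewal m = \bigcap_K no_renewal_upto m K.
Proof.
apply/seteqP; split => [w nw K _|w nw i k i0].
  by apply/no_renewal_uptoE => i k /andP[i0 _]; exact: nw.
by have /no_renewal_uptoE := nw i I; apply; rewrite i0 leqnn.
Qed.

Lemma no_renewal_measurable m : measurable (no_renewal m).
Proof.
by rewrite no_renewal_bigcap; apply: bigcapT_measurable => K; exact: mword.
Qed.

(** With a finite horizon [K] the two events concern consecutive words and are independent;
    continuity from above removes the horizon. *)
Lemma hit_no_renewal n h :
  P (hit n h `&` no_renewal n) = (P (hit n h) * P (no_renewal 0))%E.
Proof.
have cvgI m (C : set Omega) : measurable C ->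
    P (C `&` no_renewal_upto m K) @[K --> \oo] --> P (C `&` no_renewal m).
  move=> mC; have -> : C `&` no_renewal m = \bigcap_K (C `&` no_renewal_upto m K).
    rewrite no_renewal_bigcap; apply/seteqP; split => [w [Cw nw] K _|w H].
      by split=> //; exact: nw.
    by split=> [|K _]; [case: (H 0%N I)|case: (H K I)].
  have mI K : measurable (C `&` no_renewal_upto m K).
    by apply: measurableI => //; exact: mword.
  apply: nonincreasing_cvg_mu => //.
  - by rewrite ltey_eq fin_num_measure.
  - exact: bigcapT_measurable.
  - move=> K L KL; apply/subsetPset => w [Cw /no_renewal_uptoE nw]; split=> //.
    apply/no_renewal_uptoE => i k /andP[i0 iK]; apply: nw.
    by rewrite i0 (leq_trans iK).
have l1 := cvgI n _ (@mword 0%N n [set s | hits h s]).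
have l2 : P (hit n h `&` no_renewal_upto n K) @[K --> \oo] -->
    (P (hit n h) * P (no_renewal 0))%E.
  under eq_fun do rewrite (word_independent mxi xi_iid).
  apply: cvgeZl; first by rewrite fin_num_measure.
  by have := cvgI 0%N setT measurableT; under eq_fun do rewrite setTI; rewrite setTI.
by apply: cvg_unique l1 l2.
Qed.

Definition last_renewal h := \bigcup_n (hit n h `&` no_renewal n).

Lemma last_renewal_measurable h : measurable (last_renewal h).
Proof.
apply: bigcupT_measurable => n; apply: measurableI => //.
exact: no_renewal_measurable.
Qed.

(** If two last renewals occurred at different times, the letters between them would form a renewal
    after the earlier one. *)
Lemma last_renewal_trivIset : trivIset setT last_renewal.
Proof.
move=> h h' _ _ [w /= [[n _ [hn nn]] [n' _ [hn' nn']]]].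
wlog nm : n n' h h' hn nn hn' nn' / (n <= n')%N.
  move=> H; have [nm|/ltnW mn] := leqP n n'; first exact: (H n n').
  by apply: esym; exact: (H n' n).
have [k kE] : exists k, n' = (n + k)%N by exists (n' - n)%N; lia.
move: hn'; rewrite /= kE word_cat => hn'.
have hh' := hits_leq hn hn'.
have [k0|k0] := posnP k.
  by move: hn'; rewrite k0 cats0; exact: hits_inj.
move: hn'; rewrite -(subnKC hh') hits_cat//.
by apply: contraTeq => _; exact: nn.
Qed.

Lemma last_renewal_prob h :
  P (last_renewal h) = (P (\bigcup_n hit n h) * P (no_renewal 0))%E.
Proof.
have mnr := no_renewal_measurable.
rewrite !measure_semi_bigcup//; first last.
- exact: last_renewal_measurable.
- by apply: trivIset_setIr; exact: hit_trivIset.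
- by move=> n; exact: measurableI.
- exact: bigcupT_measurable.
- exact: hit_trivIset.
have vE := fineK (fin_num_measure P _ (mnr 0%N)).
rewrite muleC -vE -nneseriesZl//; apply: eq_eseriesr => n _.
by rewrite vE muleC; exact: hit_no_renewal.
Qed.

Lemma hit_rec n h (a b : R) :
  P [set w | ok h.+1 (xi 0 w) && down (xi 0 w)] = a%:E ->
  P [set w | ok h.+1 (xi 0 w) && ~~ down (xi 0 w)] = b%:E ->
  P (hit n.+1 h.+1) = (a%:E * P (hit n h) + b%:E * P (hit n h.+2))%E.
Proof.
pose D (f : bool -> bool) := [set s : seq E |
  if s is e :: _ then ok h.+1 e && f (down e) else false].
move=> <- <-.
rewrite -(word_independent mxi xi_iid 1 n (D id) [set s | hits h s]).
rewrite -(word_independent mxi xi_iid 1 n (D negb) [set s | hits h.+2 s]).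
rewrite -measureU.
- congr (P _); apply/seteqP; split => w /=.
    move=> /andP[-> /=]; case: (down _) => hw; by [left|right].
  by case=> -[/andP[-> /=]]; case: (down _).
- exact: measurableI.
- exact: measurableI.
- apply/seteqP; split=> // w [[/= /andP[_ dw] _] [/andP[_ ndw] _]].
  by rewrite dw in ndw.
Qed.

Variables (a b psi : nat -> R) (M : R).
Hypothesis aE : forall h,
  P [set w | ok h.+1 (xi 0 w) && down (xi 0 w)] = (a h)%:E.
Hypothesis bE : forall h,
  P [set w | ok h.+1 (xi 0 w) && ~~ down (xi 0 w)] = (b h)%:E.
Hypothesis a_bnd : forall h, 0 <= a h <= 2^-1.
Hypothesis b_bnd : forall h, 0 <= b h <= 2^-1.
Hypothesis psi0 : psi 0%N <= 1.
Hypothesis psi_bnd : forall h, psi h <= M.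
Hypothesis psi_sub : forall h, psi h.+1 <= a h * psi h + b h * psi h.+2.
Hypothesis psi_div : forall A, exists H, A < \sum_(h < H) psi h.

(** Summed over the length, [hit_rec] shows that these probabilities satisfy the equation of which
    [psi] is a subsolution; at level zero they equal one. *)
Lemma level_prob_ge h : ((psi h)%:E <= P (\bigcup_n hit n h))%E.
Proof.
pose u h := fine (P (\bigcup_n hit n h)).
have uE k : P (\bigcup_n hit n k) = (u k)%:E.
  by rewrite fineK// fin_num_measure//; exact: bigcupT_measurable.
rewrite uE lee_fin; apply: (@subharmonic_le R psi u a b M) => //.
- rewrite -lee_fin -uE (_ : \bigcup_n _ = setT) ?probability_setT ?lee_fin//.
  by apply/seteqP; split=> // w _; exists 0%N.
- by move=> k; rewrite -lee_fin -uE.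
- move=> k; rewrite -lee_fin EFinD !EFinM -!uE.
  rewrite !measure_semi_bigcup//; try by [exact: hit_trivIset|exact: bigcupT_measurable].
  rewrite -!nneseriesZl// -nneseriesD//; first last.
  - by move=> i _ _; rewrite mule_ge0// lee_fin; case/andP: (b_bnd k).
  - by move=> i _ _; rewrite mule_ge0// lee_fin; case/andP: (a_bnd k).
  rewrite [leRHS]nneseries_recl//.
  (* The empty word reaches no positive level; dropping its term shifts the index so that [hit_rec]
     applies. *)
  rewrite (_ : hit 0 k.+1 = set0); last by apply/seteqP; split=> // w.
  rewrite measure0 add0e -(nneseries_addn 1)//.
  apply: lee_nneseries => [i _ _|i _]; last first.
    by rewrite addn1; have := hit_rec i (aE k) (bE k) => <-.
  rewrite adde_ge0// mule_ge0// lee_fin; first by case/andP: (a_bnd k).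
  by case/andP: (b_bnd k).
Qed.

(** The disjoint events [last_renewal h] have probability at least [psi h * v]. With [v] positive,
    divergence of the sum of [psi] would push their total above one. *)
Lemma no_renewal_null : P (no_renewal 0) = 0.
Proof.
have mnr := no_renewal_measurable.
have vE := fineK (fin_num_measure P _ (mnr 0%N)).
set v := fine _ in vE; rewrite -vE; congr EFin.
apply/eqP; rewrite eq_le fine_ge0// andbT leNgt; apply/negP => v0.
have [H] := psi_div v^-1; apply/negP; rewrite -leNgt.
rewrite -(ler_pM2r v0) mulVf ?gt_eqF// -lee_fin.
have mlr := last_renewal_measurable.
apply: le_trans (probability_le1 P (bigsetU_measurable (index_enum 'I_H)
  (fun i _ => mlr (i : nat)))).
rewrite measure_bigsetU_ord//; last first.
  by move=> i j _ _ ij; apply/val_inj; exact: (last_renewal_trivIset I I ij).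
rewrite mulr_suml -sumEFin; apply: lee_sum => i _.
suff : ((psi i * v)%:E <= P (last_renewal i))%E by [].
rewrite last_renewal_prob EFinM -vE lee_pmul2r ?lte_fin//; exact: level_prob_ge.
Qed.

Lemma renewal_infinitely_often :
  {ae P, forall w, forall K : nat, exists n k, (K <= k)%N /\ hits k (word 0 n w)}.
Proof.
have : {ae P, forall w, forall h, ~ last_renewal h w}.
  apply: ae_foralln => h; exists (last_renewal h); split.
  - exact: last_renewal_measurable.
  - suff : P (last_renewal h) = 0 by [].
    by rewrite last_renewal_prob no_renewal_null mule0.
  - by move=> w /= /contrapT.
apply: filterS => w nlast; elim=> [|K [n [k [Kk hk]]]]; first by exists 0%N, 0%N.
have /existsNP[i /existsNP[k' /not_implyP[i0 /negP/negPn hk']]] : ~ no_renewal n w.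
  by move=> nn; apply: (nlast k); exists n.
exists (n + i)%N, (k + k')%N; rewrite word_cat add0n hits_cat//; split=> //.
(* The word between two renewals is nonempty, so the level strictly progresses. *)
suff : (0 < k')%N by lia.
rewrite lt0n; apply: contraTneq hk' => ->.
by rewrite hits0 -size_eq0 size_word -lt0n.
Qed.

End Renewal.

(** * The probability that all labels of a tree stay above a level *)

Lemma harmonic_unbounded (R : realType) (A : R) :
  exists H, A < \sum_(h < H) (h.+1%:R)^-1.
Proof.
apply: contrapT => /forallNP noH; apply: (@dvg_harmonic R).
apply: nondecreasing_is_cvgn.
  apply/nondecreasing_seqP => n; rewrite /series /= big_nat_recr//= lerDl.
  exact: harmonic_ge0.
exists A => _ [n _ <-]; rewrite /series /= big_mkord leNgt.
by apply/negP; exact: noH.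
Qed.

Lemma above_le m m' t : m' <= m -> above m t -> above m' t.
Proof.
move=> mm'; elim/ltree_ind_in: t => k ts IH /= /andP[mk ab].
rewrite (le_lt_trans mm' mk)/=; apply/allP => c cts; apply: IH => //.
by move/allP: ab; apply.
Qed.

Section TreeLaw.
Context {d : measure_display} {Omega : measurableType d} {R : realType}.
Variable P : probability Omega R.

(** [None] stands for an up-step of the bridge, which carries no tree; each direction has
    probability one half. *)
Definition letter_weight (e : option ltree) : R :=
  if e is Some t then rho R 0 t / 2 else 2^-1.

Variable xi : nat -> Omega -> option ltree.
Hypothesis mxi : forall n, discrete_rv (xi n).
Hypothesis xi_iid : forall a : seq (option ltree),
  P [set w | [seq xi i w | i <- iota 0 (size a)] = a] =
  (\prod_(e <- a) letter_weight e)%:E.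

Local Notation word := (word xi).

Definition tree_above (h : nat) : set (option ltree) :=
  [set e | if e is Some t then LT 0 t && above (- h%:Z) t else false].

Definition first_label (e : option ltree) : option int :=
  if e is Some (LNode _ (c :: _)) then Some (root_label c) else None.

(** The letter must also carry a tree, so this is half the probability that a tree has all its
    labels above [- h]. *)
Definition above_prob (h : nat) : R := fine (P (xi 0 @^-1` tree_above h)).

Lemma above_probE h : P (xi 0 @^-1` tree_above h) = (above_prob h)%:E.
Proof. by rewrite fineK// fin_num_measure//; exact: mxi. Qed.

Lemma letter_none : P [set w | xi 0 w = None] = (2^-1)%:E.
Proof.
have := xi_iid [:: None]; rewrite big_seq1 => <-; congr (P _).
by apply/seteqP; split => w /= => [->//|[]].
Qed.

Lemma letter_some (A : set Omega) : measurable A ->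
  A `<=` [set w | isSome (xi 0 w)] -> (P A <= (2^-1)%:E)%E.
Proof.
move=> mA AS.
have mN : measurable [set w | xi 0 w = None] by exact: (mxi 0 [set None]).
have : (P (~` [set w | xi 0 w = None]) = (2^-1)%:E)%E.
  by rewrite probability_setC// letter_none -EFinB; congr EFin; lra.
move=> <-; apply: le_measure; rewrite ?inE//; first exact: measurableC.
by move=> w /AS /=; case: (xi 0 w).
Qed.

Lemma above_prob_bnd h : 0 <= above_prob h <= 2^-1.
Proof.
rewrite fine_ge0//= -lee_fin -above_probE letter_some//; first exact: mxi.
by move=> w /=; case: (xi 0 w).
Qed.

(* Cutting the edge to the first child splits a tree into two trees; the child
   label [k - h] turns the bound [- h] into [- k] once the child is normalised. *)
Lemma above_prob_first h k : `|k%:Z - h%:Z| <= 1 ->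
  ((3^-1 * above_prob k * above_prob h)%:E <=
   P (xi 0 @^-1` (tree_above h `&` [set a | first_label a = Some (k%:Z - h%:Z)%R])))%E.
Proof.
move=> kh.
have mw i j := @discrete_rv_word _ _ _ xi mxi i j.
pose S : set (seq (option ltree)) := [set s | exists c r,
  [/\ s = [:: Some c; Some r], tree_above k (Some c) & tree_above h (Some r)]].
pose phi (s : seq (option ltree)) := if s is [:: Some c; Some r] then
  [:: Some (LNode 0 (tshift (k%:Z - h%:Z) c :: children r))] else [::].
have good c r : tree_above k (Some c) -> tree_above h (Some r) ->
    LT 0 (LNode 0 (tshift (k%:Z - h%:Z) c :: children r)) /\
    above (- h%:Z) (LNode 0 (tshift (k%:Z - h%:Z) c :: children r)).
  move=> /andP[/andP[wc /eqP rc] ac] /andP[/andP[wr /eqP rr] ar].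
  case: r rr wr ar => r ts /= -> wr /andP[-> ar].
  rewrite /LT /= root_tshift rc well_labelled_tshift wc eqxx andbT wr andbT ar andbT.
  rewrite -(above_tshift (k%:Z - h%:Z)) (_ : - k%:Z + _ = - h%:Z) in ac; last lia.
  by rewrite ac subr0 add0r kh.
(* A tree with [n] edges has letter weight [12^-n / 4]. Gluing merges two factors [4^-1] into one
   and adds an edge, whence [4 / 12]. *)
have := @law_transfer _ _ _ P _ _ (word 0 2) (word 0 1) setT setT S phi 3^-1
  (mw _ _) (mw _ _) measurableT measurableT.
rewrite !setTI => /(_ _)/wrap[].
  move=> s s'; rewrite !inE => -[c [r [-> _ /andP[/andP[_ /eqP rr] _]]]].
  move=> [c' [r' [-> _ /andP[/andP[_ /eqP rr'] _]]]] /= [/(can_inj (@tshiftK _)) ->].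
  by case: r rr => ? ? /= ->; case: r' rr' => ? ? /= -> ->.
move=> /(_ _)/wrap[].
  move=> _ [c [r [-> Sc Sr]]]; rewrite !setTI.
  rewrite (_ : P (word 0 1 @^-1` _) = (letter_weight
      (Some (LNode 0 (tshift (k%:Z - h%:Z) c :: children r))))%:E); last first.
    by rewrite -[letter_weight _](@big_seq1 _ _ *%R _ _ letter_weight) -xi_iid.
  rewrite (_ : P (word 0 2 @^-1` _) =
      (letter_weight (Some c) * letter_weight (Some r))%:E); last first.
    have := xi_iid [:: Some c; Some r]; rewrite !big_cons big_nil mulr1 => <-.
    by [].
  rewrite -EFinM; congr EFin; rewrite /letter_weight /rho.
  have [-> _] := good _ _ Sc Sr.
  have /andP[-> _] := Sc; have /andP[-> _] := Sr.
  case: (r) => ? ts /=; rewrite nb_edges_tshift exprD exprS.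
  by field; rewrite ?expf_neq0 ?pnatr_eq0.
move=> PE.
have {PE} : P (word 0 1 @^-1` (phi @` S)) = ((3^-1)%:E * P (word 0 2 @^-1` S))%E := PE.
have -> : word 0 2 @^-1` S = word 0 1 @^-1` [set s | tree_above k (head None s)] `&`
    word 1 1 @^-1` [set s | tree_above h (head None s)].
  apply/seteqP; split => w /=.
    by move=> [c [r [[c0 r1] kc hr]]]; split; [rewrite c0|rewrite r1].
  move=> [kc hr]; case c1 : (xi 0 w) kc => [c|//] kc.
  by case r1 : (xi 1 w) hr => [r|//] hr; exists c, r; split=> //; rewrite /word /= c1 r1.
rewrite (word_independent mxi xi_iid).
have pE j : P (word 0 1 @^-1` [set s | tree_above j (head None s)]) =
    (above_prob j)%:E by exact: above_probE.
rewrite !pE.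
rewrite -!EFinM mulrA => <-.
apply: le_measure; rewrite ?inE; [exact: mw|exact: mxi|].
move=> w [s [c [r [-> Sc Sr]]]] /= [<-] /=.
have [lt ab] := good _ _ Sc Sr; split; first exact/andP.
by rewrite /= root_tshift; case/andP: Sc => /andP[_ /eqP ->]; rewrite add0r.
Qed.

Lemma above_prob_leaf h : (0 < h)%N ->
  ((4^-1)%:E <=
   P (xi 0 @^-1` (tree_above h `&` [set a | first_label a = None])))%E.
Proof.
move=> h0.
have : P [set w | xi 0 w = Some (LNode 0 [::])] = (4^-1)%:E.
  have := xi_iid [:: Some (LNode 0 [::])]; rewrite big_seq1 /= /rho /=.
  rewrite expr0 invr1 => e; transitivity ((1 / 2 / 2 : R)%:E); last by congr EFin; lra.
  by rewrite -e; congr (P _); apply/seteqP; split => w /= => [->//|[]].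
move=> <-; apply: le_measure; rewrite ?inE; [exact: (mxi 0 [set _])|exact: mxi|].
by move=> w /= ->; split=> //=; rewrite andbT oppr_lt0 ltz_nat.
Qed.

(** The disjoint cases are a tree reduced to its root, and a first child labelled -1, 0 or 1. *)
Lemma above_prob_rec h : 4^-1 + 3^-1 *
  (above_prob h + above_prob h.+1 + above_prob h.+2) * above_prob h.+1
  <= above_prob h.+1.
Proof.
rewrite -lee_fin -(above_probE h.+1).
pose X o := xi 0 @^-1` (tree_above h.+1 `&` [set a | first_label a = o]).
have mX o : measurable (X o) by exact: mxi.
have dX o (F : set Omega) : (forall w, F w -> first_label (xi 0 w) <> o) -> X o `&` F = set0.
  by move=> ho; apply/seteqP; split=> // w [[_ /= wo] /ho].
apply: (@le_trans _ _ (P (X None `|` (X (Some (h%:Z - h.+1%:Z)) `|`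
    (X (Some (h.+1%:Z - h.+1%:Z)) `|` X (Some (h.+2%:Z - h.+1%:Z))))))); last first.
  apply: le_measure; rewrite ?inE; [|exact: mxi|].
    by do 3! apply: measurableU => //.
  by move=> w [[]|[[]|[[]|[]]]].
rewrite measureU//; [|by do 2! apply: measurableU => //|]; last first.
  by apply: dX => w [[_ /= ->]|[[_ /= ->]|[_ /= ->]]].
rewrite measureU//; [|by apply: measurableU => //|]; last first.
  by apply: dX => w [[_ /= ->]|[_ /= ->]]; case; lia.
rewrite measureU//; last by apply: dX => w [_ /= ->]; case; lia.
rewrite !mulrDr !mulrDl !EFinD -!addeA.
by rewrite leeD ?above_prob_leaf// !leeD// above_prob_first//; lia.
Qed.

(** This exact solution of the first-child equation includes the factor one half of [above_prob]. *)
Definition survival (h : nat) : R :=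
  h%:R * (h%:R + 3) / (2 * ((h%:R + 1) * (h%:R + 2))).

Lemma survivalE h : survival h.+1 = 4^-1 + 3^-1 *
  (survival h + survival h.+1 + survival h.+2) * survival h.+1.
Proof.
rewrite /survival -!natr1; have : 0 <= h%:R :> R by [].
by move: (h%:R : R) => x x0; field; lra.
Qed.

Lemma survival_le h : survival h <= 2^-1.
Proof.
rewrite /survival; have : 0 <= h%:R :> R by [].
by move: (h%:R : R) => x x0; rewrite ler_pdivrMr; nra.
Qed.

(** Dividing the two relations by [a1] and [p1] and subtracting gives
    [(X - Y) / 3 >= (a1 - p1) / (4 a1 p1)], where [X] and [Y] are the sums of three terms; moreover
    [a1 p1 <= 1 / 4]. *)
Lemma fixed_point_gap (a0 a1 a2 p0 p1 p2 : R) :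
  a1 = 4^-1 + 3^-1 * (a0 + a1 + a2) * a1 ->
  4^-1 + 3^-1 * (p0 + p1 + p2) * p1 <= p1 ->
  0 <= p1 -> a1 <= 2^-1 -> p1 < a1 ->
  a1 - p1 <= 3^-1 * ((a0 - p0) + (a1 - p1) + (a2 - p2)).
Proof.
set X := a0 + a1 + a2; set Y := p0 + p1 + p2 => aE pE p0' a12 pa.
rewrite (_ : _ + _ + _ = X - Y); last by rewrite /X /Y; ring.
have p1_gt0 : 0 < p1.
  by rewrite lt0r p0' andbT; apply: contraTneq pE => ->; rewrite !mulr0; lra.
have ap : 0 < a1 * p1 by rewrite mulr_gt0//; lra.
have ap4 : a1 * p1 <= 4^-1 by nra.
have h1 : a1 * 4^-1 <= a1 * (p1 - 3^-1 * Y * p1) by rewrite ler_pM2l; lra.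
have h2 : p1 * a1 = p1 * (4^-1 + 3^-1 * X * a1) by congr (_ * _).
have h3 : (a1 - p1) * 4^-1 <= a1 * p1 * (3^-1 * (X - Y)) by lra.
rewrite -(ler_pM2l ap); apply: le_trans h3.
by rewrite mulrC ler_pM2l//; lra.
Qed.

(** By [fixed_point_gap] the positive part of the difference is at most the mean of itself and its
    two neighbours, which amounts to convexity. *)
Lemma above_prob_ge h : survival h <= above_prob h.
Proof.
pose e k := Num.max (survival k - above_prob k) 0.
have e0 k : 0 <= e k by rewrite le_max lexx orbT.
have fe k : survival k - above_prob k <= e k by rewrite le_max lexx.
suff : e h = 0 by have := fe h; lra.
apply: (@bounded_convex_eq0 _ e 2^-1).
- apply/max_idPr; rewrite /survival !mul0r sub0r oppr_le0.
  by case/andP: (above_prob_bnd 0).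
- move=> k; rewrite e0 ge_max; have := survival_le k.
  by have /andP[] := above_prob_bnd k; lra.
- move=> k; have [pa|ap] := ltP (above_prob k.+1) (survival k.+1); last first.
    have -> : e k.+1 = 0 by apply/max_idPr; lra.
    by rewrite mulr0 addr_ge0.
  have -> : e k.+1 = survival k.+1 - above_prob k.+1 by apply/max_idPl; lra.
  have /andP[p0 _] := above_prob_bnd k.+1.
  have := fixed_point_gap (survivalE k) (above_prob_rec k) p0 (survival_le _) pa.
  by have := fe k; have := fe k.+2; lra.
Qed.

End TreeLaw.

(** * The letters of the random bridge *)

Definition normalize (t : ltree) : ltree := tshift (- root_label t) t.

(** Normalising removes the dependence on the height of the walk, so that letters become identically
    distributed. *)
Definition letter (b : treed_bridge) (i : int) : option ltree :=
  if DS b i then Some (normalize (tb_tree b i)) else None.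

(* [left = false] reads the bridge from [0] to the right, [left = true] reads it
   from [0] to the left; the [n]-th step crosses the edge whose left endpoint is
   [side_pos left n]. *)
Definition side (left : bool) (n : nat) : int := if left then - n%:Z else n%:Z.

Definition side_pos (left : bool) (n : nat) : int := side left (n + left).

Definition side_sgn (left : bool) : int := if left then 1 else -1.

Lemma side_inj left : injective (side left).
Proof. by move=> i j; rewrite /side; case: left; lia. Qed.

Lemma side_step left b n :
  tb_walk b (side left n.+1) - tb_walk b (side left n) =
  if DS b (side_pos left n) then side_sgn left else - side_sgn left.
Proof.
rewrite /side_pos /side /side_sgn; case: left => /=.
  have := walk_step b (- n%:Z); rewrite addn1 (_ : - n.+1%:Z = - n%:Z - 1); last lia.
  rewrite /DS /down_steps subrK.
  by move: (tb_walk b (- n%:Z)) (tb_walk b (- n%:Z - 1)) => u v; case: eqP; lia.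
have := tb_step b n%:Z; rewrite addn0 (_ : n.+1%:Z = n%:Z + 1); last lia.
rewrite /DS /down_steps.
by move: (tb_walk b n%:Z) (tb_walk b (n%:Z + 1)) => u v; case: eqP; lia.
Qed.

Lemma rho_tshift (R : realType) a k t : rho R (k + a) (tshift a t) = rho R k t.
Proof. by rewrite /rho LT_tshift nb_edges_tshift. Qed.

Section Letters.
Context {d : measure_display} {Omega : measurableType d} {R : realType}.
Variable P : probability Omega R.
Variable B : Omega -> treed_bridge.
Let X i w := tb_walk (B w) i.
Let T i w := tb_tree (B w) i.
Hypothesis trees : conditionally_independent_trees P X T.

(** Measurability of [T i] is given only where [i] is a down-step, so preimages are split along that
    event. *)
Lemma discrete_rv_letter i : discrete_rv (fun w => letter (B w) i).
Proof.
move=> A; have [mT _] := trees.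
have mD : measurable [set w | DS (B w) i].
  rewrite (_ : mkset _ = [set w | down_steps (X^~ w) i /\ setT (T i w)]); first exact: mT.
  by apply/seteqP; split => [w /=|w []].
rewrite (_ : _ @^-1` A = [set w | down_steps (X^~ w) i /\
    [set t | A (Some (normalize t))] (T i w)] `|`
    (~` [set w | DS (B w) i] `&` [set _ | A None])); last first.
  apply/seteqP; split => w /=; rewrite /letter.
    by case: ifP => [dw Aw|/negP ndw AN]; [left|right].
  by move=> [[dw Aw]|[/negP/negbTE ndw AN]]; rewrite ?ndw// /DS dw.
apply: measurableU; first exact: mT.
apply: measurableI; first exact: measurableC.
have [AN|AN] := pselect (A None).
  by rewrite (_ : mkset _ = setT)//; apply/seteqP; split.
by rewrite (_ : mkset _ = set0)//; apply/seteqP; split.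
Qed.

Variable left : bool.
Hypothesis srw : simple_random_walk P (fun n => X (side left n)).

Let xi n w := letter (B w) (side_pos left n).
Let st (e : option ltree) : int := if e then side_sgn left else - side_sgn left.

(** Fixing the word fixes the walk, an event [A] of probability [2^-n], and the trees at the
    positions [J]. On [A] the root labels are constants, which shift invariance of [rho] removes. *)
Lemma letters_iid (a : seq (option ltree)) :
  P [set w | [seq xi i w | i <- iota 0 (size a)] = a] =
  (\prod_(e <- a) (letter_weight e : R))%:E.
Proof.
have [mX X0 Xhalf Xind] := srw; have [_ PT] := trees.
set n := size a; pose e i := nth None a i.
pose x i : int := \sum_(0 <= j < i) st (e j).
have xS i : x i.+1 = x i + st (e i) by rewrite /x big_nat_recr.
pose A := [set w | forall i, (i <= n)%N -> X (side left i) w = x i].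
pose J := [seq side_pos left i | i <- iota 0 n & e i].
(* [index] recovers the time from the position. The tree sits at the left endpoint of the step,
   reached at time [i + left]. *)
pose t j := let i := index j [seq side_pos left i | i <- iota 0 n] in
  tshift (x (i + left)%N) (odflt (LNode 0 [::]) (e i)).
have tE i : (i < n)%N -> t (side_pos left i) =
    tshift (x (i + left)%N) (odflt (LNode 0 [::]) (e i)).
  move=> ni; rewrite /t index_map; last by move=> k l /side_inj /addIn.
  suff -> : index i (iota 0 n) = i by [].
  by rewrite -{1}[i](@nth_iota 0 0 n i)// index_uniq ?iota_uniq ?size_iota.
have AP w : A w <-> forall i, (i < n)%N ->
    DS (B w) (side_pos left i) = e i :> bool.
  split=> [Aw i ni|Dw i].
    have := side_step left (B w) i; rewrite -!/(X _ _) !Aw//; last exact: ltnW.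
    rewrite xS /st /side_sgn; move: (x i) (DS _ _) => y D.
    by case: (e i) => [?|]; case: D => //; case: (left) => /=; lia.
  elim: i => [_|i IH ni]; first by rewrite /x big_geq// X0.
  have := side_step left (B w) i; rewrite -!/(X _ _) Dw// IH; last exact: ltnW.
  rewrite xS /st; move: (x i) (X _ _) => y z.
  by case: (e i) => [?|]; lia.
have AX w i : A w -> (i < n)%N -> e i -> X (side_pos left i) w = x (i + left)%N.
  move=> Aw ni ei; rewrite /side_pos Aw//; case: (left); lia.
have LE : [set w | [seq xi i w | i <- iota 0 n] = a] =
    A `&` [set w | forall i, i \in J -> down_steps (X^~ w) i /\ T i w = t i].
  apply/seteqP; split => w /=.
    move=> wa; have wE i : (i < n)%N -> xi i w = e i.
      by move=> ni; rewrite /e -wa (nth_map 0%N) ?size_iota// nth_iota.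
    have Aw : A w.
      by apply/AP => i ni; rewrite -wE// /xi /letter; case: ifP.
    split=> // _ /mapP[i + ->]; rewrite mem_filter mem_iota => /andP[ei ni].
    have := wE i ni; rewrite tE// /xi /letter.
    case: ifP => [dw|_ e0]; last by rewrite -e0 in ei.
    move=> ee; split=> //; rewrite -ee /= -(AX w)//.
    by rewrite /normalize root_label_tb// tshiftNK.
  move=> [Aw Tw]; apply: (@eq_from_nth _ None); first by rewrite size_map size_iota.
  move=> i; rewrite size_map size_iota => ni.
  rewrite (nth_map 0%N) ?size_iota// nth_iota// add0n /xi /letter.
  have /AP/(_ i ni) -> := Aw; rewrite -/(e i); case ei : (e i) => [t'|//] /=.
  have [|_] := Tw (side_pos left i).
    by apply: map_f; rewrite mem_filter ei mem_iota.
  have di : DS (B w) (side_pos left i) by have /AP -> := Aw; rewrite ?ei.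
  rewrite tE// ei /= /normalize root_label_tb// -/(X _ _) (AX w)// ?ei// /T => ->.
  by rewrite tshiftK.
have AI : A = \bigcap_(i in [set i | (i <= n)%N]) (X (side left i) @^-1` [set x i]).
  by apply/seteqP; split.
have mA : measurable A.
  by rewrite AI; apply: bigcap_measurableType => i _; exact: mX.
have sA : sigma_of X A.
  rewrite AI; pose G := [set C | exists i (D : set int), C = X i @^-1` D].
  apply: (@bigcap_measurableType _ (g_sigma_algebraType G)) => i _.
  by apply: sub_sigma_algebra; exists (side left i), [set x i].
have uJ : uniq J.
  rewrite map_inj_uniq ?filter_uniq ?iota_uniq// => k l.
  by rewrite /side_pos => /side_inj /addIn.
have PA : P A = (\prod_(i <- iota 0 n) (2^-1)%:E)%E.
  pose step i w := X (side left i.+1) w - X (side left i) w.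
  transitivity (P [set w | forall i, i \in iota 0 n -> [set st (e i)] (step i w)]).
    congr (P _); apply/seteqP; split => w /= Aw.
      move=> i; rewrite mem_iota => /andP[_ ni]; rewrite /step !Aw//; last exact: ltnW.
      by rewrite xS addrC addKr.
    elim=> [_|i IH ni]; first by rewrite /x big_geq// X0.
    have := Aw i; rewrite mem_iota add0n ni /step IH; last exact: ltnW.
    by move=> /(_ isT); rewrite xS => <-; rewrite addrC subrK.
  rewrite (Xind (iota 0 n) (fun i => [set st (e i)]))// ?iota_uniq//.
  apply: eq_bigr => i _; have [P1 PN1] := Xhalf i.
  have [->|->] : st (e i) = 1 \/ st (e i) = -1; last exact: PN1; last exact: P1.
  rewrite /st /side_sgn; case: (e i) => [?|]; case: (left) => /=; rewrite ?opprK;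
    by [left|right].
rewrite -/n LE PT//.
pose c i : R := if e i is Some t' then rho R 0 t' else 1.
transitivity (\int[P]_(w in A) (cst (\prod_(i <- iota 0 n) c i)%:E) w)%E.
  apply: eq_integral => w; rewrite inE => Aw; congr EFin.
  rewrite big_map big_filter big_mkcond; apply: eq_big_seq => i.
  rewrite mem_iota => /andP[_ ni]; rewrite /c.
  case ei : (e i) => [t'|//].
  have -> : down_steps (X^~ w) (side_pos left i) by have /AP/(_ i ni) := Aw; rewrite ei.
  rewrite (AX w i)// ?ei// tE// ei /=.
  by rewrite -{1}[x _]add0r rho_tshift.
transitivity ((\prod_(i <- iota 0 n) c i)%:E * P A)%E; first exact: integral_cst.
rewrite PA (big_nth None) /index_iota subn0 -/n.
rewrite prodEFin -EFinM -big_split/=; congr EFin.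
apply: eq_bigr => i _; rewrite /c -/(e i) /letter_weight mulrC.
by case: (e i) => [?|]; rewrite ?mulr1// mulrC.
Qed.

End Letters.

(** Read leftwards, a step with a tree goes up and the tree sits at its far end, one level above the
    current one. Relative to its root the target is one lower, whence [+ left]. *)
Definition side_ok (left : bool) (h : nat) (e : option ltree) : bool :=
  if e is Some t then above (- (h + left)%:Z) t else true.

Definition side_down (left : bool) (e : option ltree) : bool :=
  if left then ~~ isSome e else isSome e.

Lemma side_ok_mono left h k e : side_ok left h e -> side_ok left (h + k) e.
Proof. by case: e => //= t; apply: above_le; lia. Qed.

(** The target level, the current value of the walk minus the height, is invariant along the
    recursion; each tree is compared with it after undoing the normalisation. *)
Lemma hits_levels left b h m n :
  hits (side_ok left) (side_down left) h
    [seq letter b (side_pos left i) | i <- iota m n] ->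
  tb_walk b (side left (m + n)) = tb_walk b (side left m) - h%:Z /\
  forall i, (m <= i < m + n)%N -> DS b (side_pos left i) ->
    above (tb_walk b (side left m) - h%:Z) (tb_tree b (side_pos left i)).
Proof.
elim: n h m => [|n IH] h m.
  by move=> /eqP ->; rewrite addn0 subr0; split=> // i; lia.
rewrite /= => /and3P[h0 okm /IH{IH}].
set h' := if _ then _ else _ => -[].
have [Ym' rm] : tb_walk b (side left m.+1) - h'%:Z = tb_walk b (side left m) - h%:Z /\
    (DS b (side_pos left m) ->
     tb_walk b (side_pos left m) = tb_walk b (side left m) + left%:Z).
  have := side_step left b m; rewrite /h' /side_down /side_sgn /side_pos /letter.
  by case: (left) => /=; rewrite ?addn0 ?addn1; case: ifP => /=; lia.
rewrite Ym' addSnnS => -> ab; split=> // i.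
rewrite leq_eqVlt => /andP[/predU1P[<- _ dm|mi im]]; last by apply: ab; lia.
move: okm; rewrite /letter dm /= /normalize root_label_tb// rm//.
rewrite -(above_tshift (- (tb_walk b (side left m) + left%:Z)) (_ - _)).
by congr (above _ _); lia.
Qed.

(** * Cuts of the random bridge *)

Section Cuts.
Context {d : measure_display} {Omega : measurableType d} {R : realType}.
Variable P : probability Omega R.
Variable B : Omega -> treed_bridge.
Let X i w := tb_walk (B w) i.
Let T i w := tb_tree (B w) i.
Hypothesis trees : conditionally_independent_trees P X T.
Variable left : bool.
Hypothesis srw : simple_random_walk P (fun n => X (side left n)).

Lemma cuts_infinitely_often : {ae P, forall w, forall K : nat, exists n k : nat,
  [/\ (K <= k)%N, X (side left n) w = - k%:Z &
    forall i, (i < n)%N -> DS (B w) (side_pos left i) ->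
      above (- k%:Z) (tb_tree (B w) (side_pos left i))]}.
Proof.
pose xi n w := letter (B w) (side_pos left n).
have mxi n : discrete_rv (xi n) by exact: (discrete_rv_letter trees).
have xi_iid := letters_iid trees srw.
have fin_prob (A : set (option ltree)) :
    P [set w | A (xi 0%N w)] = (fine (P [set w | A (xi 0%N w)]))%:E.
  rewrite fineK// fin_num_measure//; exact: (mxi 0%N A).
pose alive f h := [set e : option ltree | side_ok left h.+1 e && f (side_down left e)].
pose a h := fine (P [set w | alive id h (xi 0%N w)]).
pose b h := fine (P [set w | alive negb h (xi 0%N w)]).
have some_half h (A : set (option ltree)) :
    tree_above h `<=` A -> A `<=` [set e | isSome e] ->
    survival h <= fine (P [set w | A (xi 0%N w)]) <= 2^-1.
  move=> hA As; apply/andP; split.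
    apply: le_trans (above_prob_ge mxi xi_iid h) _.
    rewrite -lee_fin -(above_probE P mxi) -fin_prob; apply: le_measure; rewrite ?inE.
    - exact: mxi.
    - exact: (mxi 0%N A).
    - by move=> w /hA.
  rewrite -lee_fin -fin_prob; apply: (letter_some mxi xi_iid).
    exact: (mxi 0%N A).
  by move=> w /As.
have none_half (A : set (option ltree)) : A = [set None] ->
    fine (P [set w | A (xi 0%N w)]) = 2^-1.
  by move=> ->; rewrite (letter_none xi_iid).
(* With [survival] as the weight of the tree-carrying steps these functions are exactly harmonic;
   the larger true weights make them subsolutions. *)
pose psi h : R := if left then 3 / (h%:R + 3) else (h%:R + 1)^-1.
have surv_a h : ~~ left -> survival h.+1 <= a h <= 2^-1.
  move=> /negbTE l; apply: some_half => [[t|//]|[t|]//]; rewrite /alive /side_down /= l//.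
  by rewrite addn0 andbT => /andP[].
have surv_b h : left -> survival h.+2 <= b h <= 2^-1.
  move=> l; apply: some_half => [[t|//]|[t|]//]; rewrite /alive /side_down /= l//.
  by rewrite addn1 andbT => /andP[].
have half_a h : left -> a h = 2^-1.
  move=> l; apply: none_half; rewrite /alive /side_down l.
  by apply/seteqP; split => [[t|]|[t|]] //=; rewrite andbF.
have half_b h : ~~ left -> b h = 2^-1.
  move=> /negbTE l; apply: none_half; rewrite /alive /side_down l.
  by apply/seteqP; split => [[t|]|[t|]] //=; rewrite andbF.
have n0 (h : nat) : 0 <= h%:R :> R by [].
have := @renewal_infinitely_often _ _ _ P _ xi _ mxi xi_iid (side_ok left)
  (side_down left) (side_ok_mono (left := left)) a b psi 1 (fun h => fin_prob _)
  (fun h => fin_prob _).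
move=> /(_ _)/wrap[].
  move=> h; rewrite fine_ge0//=; have [l|l] := boolP left.
    by rewrite half_a.
  by have /andP[] := surv_a h l.
move=> /(_ _)/wrap[].
  move=> h; rewrite fine_ge0//=; have [l|l] := boolP left.
    by have /andP[] := surv_b h l.
  by rewrite half_b.
have psi_bnd h : psi h <= 1.
  rewrite /psi; case: (left).
    by rewrite ler_pdivrMr; have := n0 h; lra.
  by rewrite invf_le1; have := n0 h; lra.
move=> /(_ (psi_bnd _) psi_bnd) /(_ _)/wrap[].
  move=> h; rewrite /psi; have [l|l] := boolP left.
    have /andP[+ _] := surv_b h l; rewrite half_a// /survival.
    rewrite -[h.+2%:R]natr1 -[h.+1%:R]natr1 /=.
    have := n0 h; move: (h%:R : R) (b h) => y bh y0 sb.
    have q0 : 0 <= 3 / (y + 1 + 1 + 3) by rewrite divr_ge0; lra.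
    apply: le_trans (lerD (lexx _) (ler_wpM2r q0 sb)).
    by rewrite le_eqVlt; apply/orP; left; apply/eqP; field; lra.
  have /andP[+ _] := surv_a h l; rewrite half_b// /survival.
  rewrite -[h.+2%:R]natr1 -[h.+1%:R]natr1 /=.
  have := n0 h; move: (h%:R : R) (a h) => y ah y0 sa.
  have q0 : 0 <= (y + 1)^-1 by rewrite invr_ge0; lra.
  apply: le_trans (lerD (ler_wpM2r q0 sa) (lexx _)).
  by rewrite le_eqVlt; apply/orP; left; apply/eqP; field; lra.
move=> /(_ _)/wrap[].
  move=> A; have [H AH] := harmonic_unbounded A; exists H.
  apply: lt_le_trans AH _; apply: ler_sum => h _; rewrite /psi -natr1.
  (* On the left, [3 / (h + 3)] dominates [1 / (h + 1)]. *)
  have := n0 h; move: (h%:R : R) => y y0; case: (left) => //.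
  rewrite -[leLHS]div1r ler_pdivlMr; last lra.
  by rewrite mulrAC ler_pdivrMr; lra.
apply: filterS => w H K; have [n [k [Kk hk]]] := H K.
have := hits_levels hk; rewrite add0n.
have -> : tb_walk (B w) (side left 0) = 0.
  by rewrite /side; case: left; rewrite ?oppr0 tb_walk0.
by rewrite sub0r => -[Xn ab]; exists n, k; split=> // i i_n; apply: ab.
Qed.

End Cuts.

Theorem theorem4p7 (R : realType) (d : measure_display)
    (Omega : measurableType d) (P : probability Omega R)
    (B : Omega -> treed_bridge) (hB : is_Binfty P B) :
  {ae P, forall w, forall x y : mvertex (Phi (B w)),
    (dgr R x z - dgr R y z)%E @[z --> vinfty (Phi (B w))]
      --> ((@vlabel (B w) x - @vlabel (B w) y)%:~R : R)%:E}.
Proof.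
have [srw_right srw_left _ trees] := hB.
have cuts_right := cuts_infinitely_often (left := false) trees srw_right.
have cuts_left := cuts_infinitely_often (left := true) trees srw_left.
apply: filterS2 cuts_right cuts_left => w cr cl.
have above_corner k (c : real_corner (B w)) :
    above (- k%:Z) (tb_tree (B w) (cpos c)) -> - k%:Z < clabel c.
  by move=> ab; apply: above_subtree ab _; exact: tree_vertex_contour (cidxP c).
apply: dgr_diff_cvg => K.
  have [n [k [Kk Xn ab]]] := cr K; exists n, k; split=> // c c0 cn.
  apply: above_corner; have cE : side_pos false `|cpos c|%N = cpos c.
    by rewrite /side_pos /side; lia.
  by rewrite -cE; apply: ab; [lia|rewrite cE; exact: cposP].
have [n [k [Kk Xn ab]]] := cl K; exists n, k; split=> // c c0 cn.
(* Read leftwards, step [n] has left endpoint [- (n + 1)], whence the predecessor. *)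
apply: above_corner; have cE : side_pos true `|cpos c|.-1%N = cpos c.
  by rewrite /side_pos /side; lia.
by rewrite -cE; apply: ab; [lia|rewrite cE; exact: cposP].
Qed.
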